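(* Let $X$ be a Banach space such that $X^*$ is isometrically isomorphic to $\ell_1$. Then $X$ has the BPBp-nu for compact operators.
   Context: Banach spaces are over $\mathbb{K}=\mathbb{R}$ or $\mathbb{C}$. For a Banach space $X$, $S_X$ is its unit sphere, $X^*$ its dual, $\mathcal{K}(X)$ the space of compact linear operators from $X$ to $X$, and $\Pi(X)=\{(x,x^* )\in S_X\times S_{X^*}: x^*(x)=1\}$. The numerical radius of a bounded linear operator $T$ on $X$ is $\nu(T)=\sup\{|x^*(T(x))|:(x,x^* )\in\Pi(X)\}$. A Banach space $X$ has the Bishop-Phelps-Bollobás property for numerical radius for compact operators (BPBp-nu for compact operators) if for every $0<\varepsilon<1$ there exists $\eta(\varepsilon)\in(0,1)$ such that whenever $T\in\mathcal{K}(X)$ and $(x,x^* )\in\Pi(X)$ satisfy $\nu(T)=1$ and $|x^*(T(x))|>1-\eta(\varepsilon)$, there exist $S\in\mathcal{K}(X)$ and $(y,y^* )\in\Pi(X)$ such that $\nu(S)=|y^*(S(y))|=1$, $\|T-S\|<\varepsilon$, $\|x-y\|<\varepsilon$ and $\|x^*-y^*\|<\varepsilon$. *)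

(* Defs.v *)
From HB Require Import structures.
From mathcomp Require Import all_boot all_order all_algebra.
From mathcomp Require Import complex.
From mathcomp Require Import boolp classical_sets functions reals.
From mathcomp Require Import topology normedtype sequences.

Set Implicit Arguments.
Unset Strict Implicit.
Unset Printing Implicit Defensive.
Import Order.TTheory GRing.Theory Num.Theory.
Import numFieldNormedType.Exports.
Local Open Scope classical_set_scope.
Local Open Scope ring_scope.

(* Everything is defined over an arbitrary [K : numFieldType] and is meant for
   [K := R] and [K := R[i]] with [R : realType].  The order of [R[i]] is
   partial: [x <= y] means that [y - x] is a nonnegative real.  Hence [0 < e]
   says in particular that [e] is real, and [supremum 0 A] of a nonempty set [A]
   of reals that is bounded above is the usual real supremum of [A]. *)

Section Operators.
Context {K : numFieldType}.

Definition unit_ball (X : normedModType K) : set X := [set x | `|x| <= 1].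

(* Used for bounded linear operators, and for functionals with [Y := K^o];
   elsewhere the supremum may be a default value. *)
Definition opnorm (X Y : normedModType K) (T : X -> Y) : K :=
  supremum 0 [set `|T x| | x in @unit_ball X].

Definition dual (X : normedModType K) : set (X -> K^o) :=
  [set f | linear f /\ continuous f].

Definition compact_operators (X : normedModType K) : set (X -> X) :=
  [set T | linear T /\ precompact (T @` @unit_ball X)].

End Operators.
Arguments unit_ball {K} X.
Arguments dual {K} X.
Arguments compact_operators {K} X.

Section Ell1.
Context (K : numFieldType).

Definition ell1 : set (nat -> K^o) :=
  [set u | cvgn ([normed series u] : nat -> K)].

Definition ell1_norm (u : nat -> K^o) : K :=
  limn ([normed series u] : nat -> K).

End Ell1.

(* [A] and [B] stand for linear subspaces of [U] and [V], carrying the norms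
   [normA] and [normB]; the values of [Phi] outside [A] are irrelevant. *)
Definition isometrically_isomorphic {K : numFieldType} {U V : lmodType K}
    (A : set U) (normA : U -> K) (B : set V) (normB : V -> K) : Prop :=
  exists Phi : U -> V,
    [/\ forall (a : K) (u v : U), A u -> A v ->
          Phi (a *: u + v) = a *: Phi u + Phi v,
        set_bij A B Phi
      & forall u : U, A u -> normB (Phi u) = normA u].

Definition dual_isometric_ell1 {K : numFieldType} (X : normedModType K) : Prop :=
  isometrically_isomorphic (dual X) (fun f : X -> K^o => opnorm f)
    (@ell1 K) (@ell1_norm K).

Section NumericalRadius.
Context {K : numFieldType} (X : normedModType K).

Definition states : set (X * (X -> K^o)) :=
  [set p | [/\ `|p.1| = 1, dual X p.2, opnorm p.2 = 1 & p.2 p.1 = 1]].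

Definition numerical_radius (T : X -> X) : K :=
  supremum 0 [set `|p.2 (T p.1)| | p in states].

Definition BPBp_nu_compact : Prop :=
  forall e : K, 0 < e < 1 ->
  exists2 eta : K, 0 < eta < 1 &
  forall (T : X -> X) (x : X) (f : X -> K^o),
    compact_operators X T -> states (x, f) ->
    numerical_radius T = 1 -> 1 - eta < `|f (T x)| ->
  exists (S : X -> X) (y : X) (g : X -> K^o),
    [/\ compact_operators X S, states (y, g),
        numerical_radius S = 1 /\ `|g (S y)| = 1
      & [/\ opnorm (T \- S) < e, `|x - y| < e & opnorm (f \- g) < e]].

End NumericalRadius.

(* Main.v *)
Require Import Defs.
From HB Require Import structures.
From mathcomp Require Import all_boot all_order all_algebra.
From mathcomp Require Import complex.
From mathcomp Require Import boolp classical_sets functions reals.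
From mathcomp Require Import topology normedtype sequences.
From mathcomp Require Import ring lra.

Set Implicit Arguments.
Unset Strict Implicit.
Unset Printing Implicit Defensive.
Import Order.TTheory GRing.Theory Num.Theory.
Import numFieldNormedType.Exports.
Local Open Scope classical_set_scope.
Local Open Scope ring_scope.

(** Write [e_j] for the functionals on [X] corresponding to the unit vectors of
    [l_1].  Let [f x = 1] and let [|f (T x)|] be almost [1].  On coordinates
    [n] carrying almost all of the mass of [f], [|e_n x| = 1] and [e_n (T x)]
    is close to [c_n = s * e_n x] for a constant [s] of modulus one.  Each
    functional [e_n o T] is an element of [l_1] almost attaining its norm at
    [x]; rounding to modulus one the coordinates of [x] that are almost
    unimodular, one gets a functional [v_n] of norm at most [1], close to
    [e_n o T], with [v_n y = c_n] for every [y] having the rounded coordinates.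
    It remains to find such a [y] in the unit ball near [x], and a compact
    contraction [T'] near [T] with [e_n o T' = v_n]; then the state obtained by
    restricting [f] to the coordinates [n] attains the norm of [T'] at [y].
    Both are instances of one interpolation theorem for compact contractions
    [Y -> X] (with [Y] the scalar field for the first).  It holds approximately
    because the required finite systems of norm constraints are solvable in the
    bidual [l_infty] (local reflexivity, from Hahn-Banach), and exactly by
    iteration.  The same interpolation of points shows that [nu(T)] is the norm
    of [T]. *)

(** * Scalars: a common interface for the real and the complex field *)

(** The interface lets one argument serve both fields. Beyond bookkeeping it contains three facts:
    [sqr_dist1], from [|1 - z|^2 = 1 - 2 re z + |z|^2]; total boundedness of the disc, as a finite
    colouring; and the recovery of a [K]-linear functional from its real part. *)
Record real_or_complex (R : realType) (K : numFieldType) := RealOrComplex {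
  ofR : {rmorphism R -> K};
  re : K -> R;
  reD : forall u v : K, re (u + v) = re u + re v;
  re_ofRM : forall (r : R) (z : K), re (ofR r * z) = r * re z;
  re_1 : re 1 = 1;
  re_ge0 : forall z : K, 0 <= z -> 0 <= re z;
  ofR_ge0 : forall r : R, 0 <= r -> 0 <= ofR r;
  reK_ge0 : forall z : K, 0 <= z -> ofR (re z) = z;
  re_le_norm : forall z : K, re z <= re `|z|;
  sqr_dist1 : forall z : K, re `|z| <= 1 -> re `|1 - z| ^+ 2 <= 2 * (1 - re z);
  disc_totally_bounded : forall t : R, 0 < t ->
    exists (k : finType) (col : K -> k), forall z z' : K,
      re `|z| <= 1 -> re `|z'| <= 1 -> col z = col z' -> re `|z - z'| <= t;
  re_lift : forall (V : lmodType K) (rho : V -> R),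
    (forall u v, rho (u + v) = rho u + rho v) ->
    (forall r v, rho (ofR r *: v) = r * rho v) ->
    exists2 phi : V -> K, (forall a u v, phi (a *: u + v) = a * phi u + phi v)
      & forall v, re (phi v) = rho v }.

(** The colour of [z] is the index of the cell of length [t] containing it, counted from [-1]. *)
Lemma real_disc_totally_bounded (R : realType) (t : R) : 0 < t ->
  exists (k : finType) (col : R -> k), forall z z' : R,
    `|z| <= 1 -> `|z'| <= 1 -> col z = col z' -> `|z - z'| <= t.
Proof.
move=> t0; pose n := Num.truncn (2 / t).
exists 'I_n.+1, (fun z => inord (Num.truncn ((z + 1) / t))) => z z'.
rewrite !ler_norml => /andP[z1 z2] /andP[z3 z4] /(congr1 val) /=.
have bd (y : R) : -1 <= y -> y <= 1 -> (Num.truncn ((y + 1) / t) < n.+1)%N.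
  move=> y1 y2; have y12 : y + 1 <= 2 by lra.
  by rewrite ltnS le_truncn// ler_pM2r ?invr_gt0.
have ht (y : R) : -1 <= y -> let k := (Num.truncn ((y + 1) / t))%:R in
    (k * t <= y + 1) /\ (y + 1 < (k + 1) * t).
  move=> y1 k; have y0 : 0 <= y + 1 by lra.
  have /truncn_itv/andP[h1 h2] : 0 <= (y + 1) / t by rewrite divr_ge0// ltW.
  rewrite -ler_pdivlMr// h1 -ltr_pdivrMr//; split => //.
  by rewrite /k -[1]/(1%:R) -natrD addn1.
rewrite !inordK ?bd// => e; have [a1 a2] := ht z z1; have [b1 b2] := ht z' z3.
move: a1 a2 b1 b2; rewrite e mulrDl mul1r => *.
by apply/andP; split; lra.
Qed.

Definition real_scalars (R : realType) : real_or_complex R R.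
Proof.
apply: (@RealOrComplex R R idfun id) => //=.
- by move=> z; exact: ler_norm.
- move=> z; rewrite ler_norml real_normK ?num_real// => /andP[z1 z2]; nra.
- exact: real_disc_totally_bounded.
- move=> V rho rhoD rhoZ; exists rho => // a u v.
  by rewrite rhoD rhoZ.
Qed.

Section Complex.
Local Open Scope complex_scope.

Definition complex_scalars (R : realType) : real_or_complex R R[i].
Proof.
have Re0 z : 0 <= z :> R[i] -> z = (complex.Re z)%:C.
  by move=> /ger0_Im; case: z => a b /= ->.
have Re_norm (z : R[i]) : `|complex.Re z| <= complex.Re `|z|.
  by have := normc_ge_Re z; rewrite [X in _ <= X]Re0// lecR.
(* Up to sign, the imaginary part of [z] is the real part of [z * 'i], which has the same
   modulus. *)
have Im_norm (z : R[i]) : `|complex.Im z| <= complex.Re `|z|.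
  have norm_i : `|'i| = 1 :> R[i].
    by rewrite normc_def /= expr0n expr1n add0r sqrtr1.
  by have := Re_norm (z * 'i); rewrite ReiNIm normrN normrM norm_i mulr1.
apply: (@RealOrComplex R R[i] (real_complex R) (@complex.Re R)) => //.
- by move=> [a b] [c d].
- by move=> r [a b] /=; rewrite mul0r subr0.
- by move=> [a b]; rewrite lecE => /andP[].
- by move=> r; rewrite ler0c.
- by move=> z /Re0 /esym.
- by move=> z; apply: le_trans (Re_norm z); exact: ler_norm.
- move=> [a b]; rewrite !normc_def /= sqr_sqrtr ?addr_ge0 ?sqr_ge0//.
  rewrite -(@expr_le1 _ 2)// ?sqrtr_ge0// sqr_sqrtr ?addr_ge0 ?sqr_ge0// => ab1.
  by rewrite sub0r sqrrN; nra.
- move=> t t0; have t20 : 0 < t / 2 by rewrite divr_gt0.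
  have [k [col h]] := real_disc_totally_bounded t20.
  exists (k * k)%type, (fun z => (col (complex.Re z), col (complex.Im z))).
  move=> z z' z1 z'1 [eRe eIm].
  have dRe := h _ _ (le_trans (Re_norm _) z1) (le_trans (Re_norm _) z'1) eRe.
  have dIm := h _ _ (le_trans (Im_norm _) z1) (le_trans (Im_norm _) z'1) eIm.
  have -> : z - z' = (complex.Re z - complex.Re z')%:C
      + 'i * (complex.Im z - complex.Im z')%:C.
    by case: z {z1 eRe eIm dRe dIm} => a b; case: z' {z'1} => c d; simpc.
  have := ler_normD (complex.Re z - complex.Re z')%:C
    ('i * (complex.Im z - complex.Im z')%:C).
  rewrite normrM [`|'i|]normc_def /= expr0n expr1n add0r sqrtr1 mul1r.
  rewrite !normc_def /= expr0n !addr0 !sqrtr_sqr.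
  by rewrite -rmorphD lecR => /le_trans; apply; lra.
- move=> V rho rhoD rhoZ.
  (* The usual complexification [rho v - 'i * rho ('i *: v)]. *)
  exists (fun v => rho v +i* - rho ('i *: v)) => // a u v.
  have aE w : rho (a *: w) =
      complex.Re a * rho w + complex.Im a * rho ('i *: w).
    rewrite {1}[a]complexE scalerDl rhoD rhoZ; congr (_ + _).
    by rewrite mulrC -scalerA rhoZ.
  have ii w : rho ('i *: ('i *: w)) = - rho w.
    have -> : 'i *: ('i *: w) = ((-1)%:C : R[i]) *: w.
      by rewrite scalerA -expr2 sqr_i rmorphN.
    by rewrite rhoZ mulN1r.
  rewrite scalerDr [in 'i *: (a *: u)]scalerA ['i * a]mulrC -scalerA !rhoD.
  rewrite !aE ii; case: a {aE} => a b; simpc; apply/eqP; rewrite eq_complex /=.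
  by apply/andP; split; apply/eqP; ring.
Qed.
End Complex.

(** * Norms with values in the real field *)

Section RealNorm.
Context {R : realType} {K : numFieldType} (S : real_or_complex R K).
Local Notation re := (re S).
Local Notation ofR := (ofR S).

(** The order of [K] may be partial; estimates are therefore made in [R], where it is total and
    linear arithmetic applies. *)
Definition rnorm (V : normedZmodType K) (x : V) : R := re `|x|.

Lemma re0 : re 0 = 0.
Proof. by have := reD S 0 0; rewrite addr0; lra. Qed.

Lemma reN z : re (- z) = - re z.
Proof. by have := reD S z (- z); rewrite subrr re0; lra. Qed.

Lemma reB z w : re (z - w) = re z - re w.
Proof. by rewrite reD reN. Qed.

Lemma re_sum (I : Type) (r : seq I) (P : pred I) (F : I -> K) :
  re (\sum_(i <- r | P i) F i) = \sum_(i <- r | P i) re (F i).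
Proof. exact: (big_morph re (reD S) re0). Qed.

Lemma re_ofR r : re (ofR r) = r.
Proof. by rewrite -[ofR r]mulr1 re_ofRM re_1 mulr1. Qed.

Lemma ler_ofR r s : (ofR r <= ofR s) = (r <= s).
Proof.
apply/idP/idP => [|rs]; last by rewrite -subr_ge0 -rmorphB ofR_ge0// subr_ge0.
by rewrite -subr_ge0 -rmorphB => /(re_ge0 S); rewrite re_ofR subr_ge0.
Qed.

Lemma ltr_ofR r s : (ofR r < ofR s) = (r < s).
Proof. by rewrite !lt_neqAle ler_ofR fmorph_eq. Qed.

Section Normed.
Context {V : normedZmodType K}.
Implicit Types x y : V.

Lemma ofR_rnorm x : ofR (rnorm x) = `|x|.
Proof. by rewrite reK_ge0. Qed.

Lemma rnorm_ge0 x : 0 <= rnorm x.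
Proof. exact: re_ge0. Qed.

Lemma rnorm_le x r : (rnorm x <= r) = (`|x| <= ofR r).
Proof. by rewrite -ofR_rnorm ler_ofR. Qed.

Lemma rnorm_lt x r : (rnorm x < r) = (`|x| < ofR r).
Proof. by rewrite -ofR_rnorm ltr_ofR. Qed.

Lemma rnormD x y : rnorm (x + y) <= rnorm x + rnorm y.
Proof. by rewrite rnorm_le rmorphD /= !ofR_rnorm ler_normD. Qed.

Lemma rnormN x : rnorm (- x) = rnorm x.
Proof. by rewrite /rnorm normrN. Qed.

Lemma rnorm0 : rnorm (0 : V) = 0.
Proof. by rewrite /rnorm normr0 re0. Qed.

Lemma rdistC x y : rnorm (x - y) = rnorm (y - x).
Proof. by rewrite /rnorm distrC. Qed.

Lemma rdist_trans y x z : rnorm (x - z) <= rnorm (x - y) + rnorm (y - z).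
Proof. by apply: le_trans (rnormD _ _); rewrite addrA subrK. Qed.

Lemma rnorm_eq0 x : rnorm x = 0 -> x = 0.
Proof.
by move=> /(congr1 ofR); rewrite ofR_rnorm rmorph0 => /eqP/[!normr_eq0]/eqP.
Qed.

Lemma rnorm_sum (I : Type) (r : seq I) (P : pred I) (F : I -> V) :
  rnorm (\sum_(i <- r | P i) F i) <= \sum_(i <- r | P i) rnorm (F i).
Proof.
elim/big_rec2: _ => [|i x r' _ h]; first by rewrite rnorm0.
by apply: le_trans (rnormD _ _) _; rewrite lerD2l.
Qed.

End Normed.

Lemma rnorm_ofR r : 0 <= r -> rnorm (ofR r) = r.
Proof. by move=> r0; rewrite /rnorm ger0_norm ?re_ofR ?ofR_ge0. Qed.

Lemma ler_addeps (a b : R) : (forall t : R, 0 < t -> a <= b + t) -> a <= b.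
Proof. by move=> h; apply/ler_addgt0Pr. Qed.

Lemma rnorm_ofR_abs r : rnorm (ofR r) = `|r|.
Proof.
case: (leP 0 r) => r0; first by rewrite rnorm_ofR// ger0_norm.
by rewrite ltr0_norm// -rnormN -rmorphN rnorm_ofR// oppr_ge0 ltW.
Qed.

Lemma rnorm1 : rnorm (1 : K) = 1.
Proof. by rewrite /rnorm normr1 re_1. Qed.

Lemma rnorm1_neq0 (z : K) : rnorm z = 1 -> z != 0.
Proof.
move=> z1; apply/eqP => z0; move: z1; rewrite z0 rnorm0 => /esym/eqP.
by rewrite oner_eq0.
Qed.

Lemma rnormM (z w : K) : rnorm (z * w) = rnorm z * rnorm w.
Proof. by rewrite {1}/rnorm normrM -(ofR_rnorm z) re_ofRM. Qed.

Lemma rnormV (z : K) : rnorm z^-1 = (rnorm z)^-1.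
Proof.
have [->|z0] := eqVneq z 0; first by rewrite invr0 rnorm0 invr0.
have n0 : rnorm z != 0 by apply/eqP => /rnorm_eq0/eqP; rewrite (negPf z0).
by apply: (mulfI n0); rewrite -rnormM !mulfV ?rnorm1.
Qed.

Lemma rnormZ (V : normedModType K) (a : K) (x : V) :
  rnorm (a *: x) = rnorm a * rnorm x.
Proof. by rewrite {1}/rnorm normrZ -(ofR_rnorm a) re_ofRM. Qed.

Lemma re_le_rnorm (z : K) : re z <= rnorm z.
Proof. exact: re_le_norm. Qed.

Lemma phase (z : K) : exists2 t : K, rnorm t = 1 & t * z = ofR (rnorm z).
Proof.
have [->|z0] := eqVneq z 0.
  by exists 1; [exact: rnorm1|rewrite mulr0 rnorm0 rmorph0].
have n0 : rnorm z != 0 by apply/eqP => /rnorm_eq0/eqP; rewrite (negPf z0).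
exists (ofR (rnorm z) * z^-1); last by rewrite mulfVK.
by rewrite rnormM rnormV rnorm_ofR ?rnorm_ge0// mulfV.
Qed.

(** The loss is quadratic: distance [r] costs a defect of order [r ^+ 2] in the real part. This is
    the source of the cubes [g ^+ 3] in the alignment estimates. *)
Lemma rnorm_dist1 (z : K) (r : R) : rnorm z <= 1 -> 0 <= r ->
  1 - re z <= r ^+ 2 / 2 -> rnorm (1 - z) <= r.
Proof.
move=> z1 r0 zr; rewrite -(@ler_pXn2r _ 2)// ?nnegrE ?rnorm_ge0//.
have h : rnorm (1 - z) ^+ 2 <= 2 * (1 - re z) := sqr_dist1 z1.
by apply: (le_trans h); lra.
Qed.

End RealNorm.

(** * The Hahn-Banach theorem for sublinear functions and gauges *)

Section HahnBanach.
Context {R : realType} {K : numFieldType} (S : real_or_complex R K).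
Context {V : lmodType K}.
Local Notation re := (re S).
Local Notation ofR := (ofR S).
Local Notation rnorm := (rnorm S).
Implicit Types (p q : V -> R) (u v x : V).

(** Homogeneity concerns real scalars only: the dominated functional is built real-linear, and
    [re_lift] makes it [K]-linear afterwards. *)
Definition sublinear p :=
  (forall u v, p (u + v) <= p u + p v) /\
  (forall r v, 0 <= r -> p (ofR r *: v) <= r * p v).

Lemma sublinear0 p : sublinear p -> p 0 = 0.
Proof.
move=> [pD pZ]; apply/eqP; rewrite eq_le; apply/andP; split.
  by have := pZ 0 0 (lexx _); rewrite scaler0 mul0r.
by have := pD 0 0; rewrite addr0; lra.
Qed.

Lemma sublinearZ p r v : sublinear p -> 0 <= r -> p (ofR r *: v) = r * p v.
Proof.
move=> sp; rewrite le_eqVlt => /predU1P[<-|r0].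
  by rewrite rmorph0 scale0r sublinear0// mul0r.
apply/eqP; rewrite eq_le (sp.2 _ _ (ltW r0)) /=.
have r1 : 0 <= r^-1 by rewrite invr_ge0 ltW.
have := sp.2 _ (ofR r *: v) r1; rewrite scalerA -rmorphM mulVf ?gt_eqF//.
by rewrite rmorph1 scale1r ler_pdivlMl.
Qed.

Lemma sublinearN_ge p v : sublinear p -> - p (- v) <= p v.
Proof.
by move=> sp; have := sp.1 v (- v); rewrite subrr sublinear0//; lra.
Qed.

(* The infimum over [r >= 0] of [p (v + r x) - r p x]. *)
Lemma sublinear_shift p x : sublinear p ->
  exists q, [/\ sublinear q, forall v, q v <= p v & q (- x) <= - p x].
Proof.
move=> sp; pose A v := [set p (v + ofR r *: x) - r * p x | r in [set r | 0 <= r]].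
have lbA v : lbound (A v) (- p (- v)).
  move=> _ [r /= r0 <-]; have := sp.1 (v + ofR r *: x) (- v).
  by rewrite addrAC subrr add0r sublinearZ//; lra.
have hlA v : has_lbound (A v) by exists (- p (- v)).
have A_neq0 v : A v !=set0 by exists (p (v + ofR 0 *: x) - 0 * p x), 0 => /=.
have qle v r : 0 <= r -> inf (A v) <= p (v + ofR r *: x) - r * p x.
  by move=> r0; apply: ge_inf => //; exists r.
exists (fun v => inf (A v)); split; first split.
- move=> u v; rewrite -lerBlDr; apply: lb_le_inf => // _ [r /= r0 <-].
  rewrite lerBlDl -lerBlDr; apply: lb_le_inf => // _ [s /= s0 <-].
  have := qle (u + v) _ (addr_ge0 r0 s0).
  have := sp.1 (u + ofR r *: x) (v + ofR s *: x).
  by rewrite addrACA -scalerDl -rmorphD; lra.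
- move=> r v; rewrite le_eqVlt => /predU1P[<-|r0].
    have := qle 0 0 (lexx _).
    by rewrite !rmorph0 !scale0r addr0 !mul0r subr0 sublinear0.
  rewrite -ler_pdivrMl//; apply: lb_le_inf => // _ [s /= s0 <-].
  rewrite ler_pdivrMl//; have := qle (ofR r *: v) _ (mulr_ge0 (ltW r0) s0).
  rewrite rmorphM -scalerA -scalerDr sublinearZ ?(ltW r0)// => /le_trans; apply.
  by rewrite mulrBr mulrA.
- by move=> v; have := qle v 0 (lexx _); rewrite rmorph0 scale0r addr0 mul0r subr0.
- have := qle (- x) 1 ler01.
  by rewrite rmorph1 scale1r addNr sublinear0// mul1r sub0r.
Qed.

(** By Zorn's lemma there is a minimal sublinear function below [p]. Minimality against
    [sublinear_shift] makes it odd, and an odd sublinear function is linear. *)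
Lemma sublinear_ge_linear p : sublinear p ->
  exists2 rho, (forall v, rho v <= p v) &
    (forall u v, rho (u + v) = rho u + rho v) /\
    (forall r v, rho (ofR r *: v) = r * rho v).
Proof.
move=> sp; pose T := {q | sublinear q /\ forall v, q v <= p v}.
(* The order is reversed, so that a maximal element for [rel] is a minimal function. *)
pose rel (q q' : T) := `[< forall v, sval q' v <= sval q v >].
have [|q1 q2 q3|q1 q2|A totA|m minm] := @Zorn T rel.
- by move=> q; apply/asboolP.
- by move=> /asboolP q12 /asboolP q23; apply/asboolP => v; exact: le_trans (q12 v).
- case: q1 q2 => [q1 h1] [q2 h2] /asboolP /= q12 /asboolP /= q21.
  apply: eq_exist; apply/funext => v.
  by apply/eqP; rewrite eq_le q12 q21.
(* A nonempty chain is bounded by its pointwise infimum, the empty one by [p]. *)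
- have [[q0 Aq0]|A0] := pselect (A !=set0); last first.
    exists (exist _ p (conj sp (fun v => lexx (p v)))) => q Aq.
    by case: A0; exists q.
  pose B v := [set sval q v | q in A].
  have hlB v : has_lbound (B v).
    exists (- p (- v)) => _ [q _ <-].
    have [sq qp] := svalP q; apply: le_trans (sublinearN_ge v sq).
    by rewrite lerN2.
  have B_neq0 v : B v !=set0 by exists (sval q0 v), q0.
  have mle v (q : T) : A q -> inf (B v) <= sval q v.
    by move=> Aq; apply: ge_inf => //; exists q.
  have sm : sublinear (fun v => inf (B v)) /\ forall v, inf (B v) <= p v.
    split; [split|].
    + move=> u v; rewrite -lerBlDr; apply: lb_le_inf => // _ [q Aq <-].
      rewrite lerBlDl -lerBlDr; apply: lb_le_inf => // _ [q' Aq' <-].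
      (* Two members of the chain are comparable, so the smaller one serves both arguments in the
         subadditivity estimate. *)
      have [/asboolP h|/asboolP h] := totA _ _ Aq Aq'.
        have := mle (u + v) _ Aq'; have := (svalP q').1.1 u v.
        by have := h u; lra.
      have := mle (u + v) _ Aq; have := (svalP q).1.1 u v.
      by have := h v; lra.
    + move=> r v; rewrite le_eqVlt => /predU1P[<-|r0].
        rewrite mul0r rmorph0 scale0r; apply: le_trans (mle _ _ Aq0) _.
        by rewrite (sublinear0 (svalP q0).1).
      rewrite -ler_pdivrMl//; apply: lb_le_inf => // _ [q Aq <-].
      rewrite ler_pdivrMl// -(sublinearZ v (svalP q).1 (ltW r0)).
      exact: mle.
    + by move=> v; apply: le_trans (mle _ _ Aq0) _; exact: (svalP q0).2.
  by exists (exist _ (fun v => inf (B v)) sm : T) => q Aq; apply/asboolP => v; exact: mle.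
- have [sm mp] := svalP m; set rho := sval m in sm mp.
  have odd x : rho (- x) = - rho x.
    have [q [sq qm qx]] := sublinear_shift x sm.
    have qT : sublinear q /\ forall v, q v <= p v.
      by split => // v; exact: le_trans (mp v).
    have : rel m (exist _ q qT) by apply/asboolP.
    move=> /minm/(congr1 sval) /= eqm; apply/eqP; rewrite eq_le.
    by move: qx; rewrite eqm => -> /=; have := sublinearN_ge (- x) sm; rewrite opprK; lra.
  exists rho => //; split.
    move=> u v; apply/eqP; rewrite eq_le sm.1 /=.
    by have := sm.1 (u + v) (- v); rewrite addrK odd; lra.
  move=> r v; have [r0|r0] := leP 0 r; first exact: sublinearZ.
  have := sublinearZ v sm (ltW (_ : 0 < - r)); rewrite oppr_gt0 => /(_ r0).
  by rewrite rmorphN scaleNr odd mulNr => /oppr_inj.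
Qed.

(* A seminorm is presented by a relation [P s v], "the seminorm of [v] is at
   most [s]", so that quotient and product seminorms need no infimum. *)
Lemma hahn_banach_gauge (P : R -> V -> Prop) (x : V) :
  (forall s v, P s v -> 0 <= s) ->
  (forall s u t v, P s u -> P t v -> P (s + t) (u + v)) ->
  (forall a s v, P s v -> P (rnorm a * s) (a *: v)) ->
  (forall v, exists s, P s v) ->
  (forall s, P s x -> 1 <= s) ->
  exists phi : V -> K,
    [/\ forall a u v, phi (a *: u + v) = a * phi u + phi v,
        forall s v, P s v -> rnorm (phi v) <= s
      & 1 <= re (phi x)].
Proof.
move=> P0 PD PZ Pex Px; pose A v := [set s | P s v].
have hlA v : has_lbound (A v) by exists 0 => s /P0.
have A_neq0 v : A v !=set0 by have [s] := Pex v; exists s.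
pose p v := inf (A v).
have ple s v : P s v -> p v <= s by move=> Ps; apply: ge_inf.
have sp : sublinear p.
  split.
  - move=> u v; rewrite -lerBlDr; apply: lb_le_inf => // s Ps.
    rewrite lerBlDl -lerBlDr; apply: lb_le_inf => // t Pt.
    by rewrite lerBlDl addrC; apply: ple; rewrite addrC; exact: PD.
  - move=> r v; rewrite le_eqVlt => /predU1P[<-|r0].
      have [s /(PZ 0)] := Pex v; rewrite rmorph0 rnorm0 !mul0r => /ple.
      by rewrite scale0r.
    rewrite -ler_pdivrMl//; apply: lb_le_inf => // s Ps.
    rewrite ler_pdivrMl//; apply: ple.
    by have := PZ (ofR r) _ _ Ps; rewrite rnorm_ofR// ltW.
(* The shift forces any linear [rho] below [q] to satisfy [rho (- x) <= - p x], that is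
   [rho x >= p x]. *)
have [q [sq qp qx]] := sublinear_shift x sp.
have [rho rhoq [rhoD rhoZ]] := sublinear_ge_linear sq.
have [phi philin phire] := re_lift rhoD rhoZ.
exists phi; split => //.
  (* A unimodular factor turns the modulus of [phi v] into a real part, which is dominated by the
     gauge. *)
  move=> s v Psv; have [t t1 tphi] := phase S (phi v).
  have phi0 : phi 0 = 0.
    have := philin (-1) 0 0; rewrite scaler0 addr0 mulN1r => {1}->.
    by rewrite addNr.
  have phiZ : phi (t *: v) = t * phi v.
    by rewrite -[t *: v]addr0 philin phi0 addr0.
  rewrite -(re_ofR S (rnorm _)) -tphi -phiZ phire.
  apply: le_trans (rhoq _) _; apply: le_trans (qp _) _; apply: ple.
  by have := PZ t _ _ Psv; rewrite t1 mul1r.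
have rhoN : rho (- x) = - rho x.
  by rewrite -scaleN1r -(rmorph1 ofR) -rmorphN rhoZ mulN1r.
have px : 1 <= p x by apply: lb_le_inf.
by rewrite phire; have := rhoq (- x); rewrite rhoN; lra.
Qed.

End HahnBanach.

(** * Limits, bounded functionals and compact operators in terms of real bounds *)

Section Analysis.
Context {R : realType} {K : numFieldType} (S : real_or_complex R K).
Local Notation re := (re S).
Local Notation ofR := (ofR S).
Local Notation rnorm := (rnorm S).

Lemma linear_at0 (Y Z : lmodType K) (T : Y -> Z) : linear T -> T 0 = 0.
Proof.
by move=> lT; have := lT (-1) 0 0; rewrite scaler0 addr0 scaleN1r => {1}->; rewrite addNr.
Qed.

Lemma linear_scale (Y Z : lmodType K) (T : Y -> Z) a y :
  linear T -> T (a *: y) = a *: T y.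
Proof. by move=> lT; rewrite -[a *: y]addr0 lT (linear_at0 lT) addr0. Qed.

Lemma linear_ball_bound (Y Z : normedModType K) (T : Y -> Z) (c : R) :
  linear T -> (forall y, rnorm y <= 1 -> rnorm (T y) <= c) ->
  forall y, rnorm (T y) <= c * rnorm y.
Proof.
move=> lT Tc x; have [x0|xn0] := eqVneq (rnorm x) 0.
  by rewrite (rnorm_eq0 x0) (linear_at0 lT) !rnorm0 mulr0.
have xp : 0 < rnorm x by rewrite lt_neqAle eq_sym xn0 rnorm_ge0.
pose y := ofR (rnorm x)^-1 *: x.
have xE : x = ofR (rnorm x) *: y.
  by rewrite scalerA -rmorphM mulfV// rmorph1 scale1r.
have y1 : rnorm y <= 1.
  by rewrite rnormZ rnorm_ofR ?invr_ge0 ?rnorm_ge0// mulVf.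
rewrite {1}xE linear_scale// rnormZ rnorm_ofR ?rnorm_ge0// mulrC.
by rewrite ler_wpM2r ?rnorm_ge0// Tc.
Qed.

Lemma ofR_gt0_re (e : K) : 0 < e -> 0 < re e /\ ofR (re e) = e.
Proof.
move=> e0; have eE := reK_ge0 S (ltW e0); split => //.
by rewrite -(ltr_ofR S) eE rmorph0.
Qed.

Lemma cvgn_rnormP (V : normedModType K) (u : nat -> V) (l : V) :
  (u @ \oo --> l) <->
  forall t : R, 0 < t -> exists N, forall n, (N <= n)%N -> rnorm (l - u n) <= t.
Proof.
split=> [/cvgrPdist_le h t t0|h].
  have /h[N _ hN] : 0 < ofR t by rewrite -(rmorph0 ofR) ltr_ofR.
  by exists N => n /hN; rewrite rnorm_le.
apply/cvgrPdist_le => e /ofR_gt0_re[/h[N hN] eE]; exists N => // n /= /hN.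
by rewrite rnorm_le eE.
Qed.

Lemma divr_pow2_le (c t : R) : 0 < t -> exists N, c / 2 ^+ N <= t.
Proof.
move=> t0; exists (Num.truncn (c / t)).+1; set N := (Num.truncn _).+1.
have N2 : (N%:R : R) <= 2 ^+ N by rewrite -natrX ler_nat ltnW// ltn_expl.
have cN : c / t < N%:R by exact: truncnS_gt.
rewrite ler_pdivrMr ?exprn_gt0// -ler_pdivrMl// mulrC.
exact: le_trans (ltW cN) N2.
Qed.

Lemma le0_geometric (c x : R) : (forall n, x <= c / 2 ^+ n) -> x <= 0.
Proof.
move=> h; apply: ler_addeps => t t0; have [n cn] := divr_pow2_le c t0.
by rewrite add0r; apply: le_trans (h n) cn.
Qed.

Lemma geometric_cauchy (X : completeNormedModType K) (u : nat -> X) (c : R) :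
  0 <= c -> (forall n, rnorm (u n.+1 - u n) <= c / 2 ^+ n) ->
  exists l, forall n, rnorm (l - u n) <= 2 * c / 2 ^+ n.
Proof.
move=> c0 uc.
(* The bound is kept as a difference so that the induction on [m] telescopes. *)
have dist m n : rnorm (u (n + m)%N - u n) <= 2 * c / 2 ^+ n - 2 * c / 2 ^+ (n + m).
  elim: m => [|m IH]; first by rewrite addn0 !subrr rnorm0.
  apply: le_trans (rdist_trans S (u (n + m)%N) _ _) _; rewrite addnS.
  have p0 : 2 ^+ (n + m) != 0 :> R by rewrite expf_neq0// pnatr_eq0.
  have := uc (n + m)%N; have -> : c / 2 ^+ (n + m) = 2 * c / 2 ^+ (n + m).+1.
    by rewrite exprS; field.
  move: IH; have -> : 2 * c / 2 ^+ (n + m) = 2 * (2 * c / 2 ^+ (n + m).+1).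
    by rewrite exprS; field.
  by lra.
have dist' n m : (n <= m)%N -> rnorm (u m - u n) <= 2 * c / 2 ^+ n.
  move=> /subnKC <-; apply: le_trans (dist _ _) _.
  by rewrite gerBl divr_ge0 ?mulr_ge0 ?exprn_ge0.
have /cauchy_cvgP/cvg_ex[l ul] : cauchy (u @ \oo).
  apply/cauchy_exP => e /ofR_gt0_re[e0 eE].
  have [|N hN] := @divr_pow2_le (2 * c) (re e / 2); first by rewrite divr_gt0.
  exists (u N), N => // n /= /dist' un; rewrite -ball_normE /ball_ /=.
  rewrite -eE -rnorm_lt rdistC; apply: le_lt_trans (le_trans un hN) _; lra.
exists l => n; apply/ler_addgt0Pr => t t0.
have [N hN] := (cvgn_rnormP u l).1 ul t t0.
have := rdist_trans S (u (N + n)%N) l (u n).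
have := hN _ (leq_addr n N); have := dist' _ _ (leq_addl N n).
by lra.
Qed.

Definition functional (X : normedModType K) (f : X -> K) :=
  (forall a x y, f (a *: x + y) = a * f x + f y) /\
  exists2 C : R, 0 <= C & forall x, rnorm (f x) <= C * rnorm x.

Lemma dualP (X : normedModType K) (f : X -> K^o) : dual X f <-> functional f.
Proof.
split=> -[lf h]; split => //.
- pose g : {linear X -> K^o} := HB.pack f (GRing.isLinear.Build K X K^o *:%R f lf).
  have : bounded_near g (nbhs 0) by apply/linear_bounded_continuous.
  move=> /linear_boundedP /pinfty_ex_gt0[M M0 hM].
  have [M0' ME] := ofR_gt0_re M0; exists (re M) => [|x]; first exact: ltW.
  by rewrite rnorm_le rmorphM /= ME ofR_rnorm hM.
- pose g : {linear X -> K^o} := HB.pack f (GRing.isLinear.Build K X K^o *:%R f lf).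
  have [C C0 hC] := h; apply/(linear_bounded_continuous g)/linear_boundedP.
  exists (ofR C); split; first by rewrite ger0_real// ofR_ge0.
  move=> r /ltW Cr x; have := hC x; rewrite rnorm_le rmorphM /= ofR_rnorm.
  by move=> /le_trans; apply; rewrite ler_wpM2r.
Qed.

(* A finite colouring of the unit ball with small images of the colour classes:
   unlike finite nets, colourings for several maps combine by taking products. *)
Definition ball_totally_bounded (Y Z : normedModType K) (T : Y -> Z) :=
  forall t : R, 0 < t -> exists (k : finType) (col : Y -> k),
  forall y y', rnorm y <= 1 -> rnorm y' <= 1 -> col y = col y' ->
    rnorm (T y - T y') <= t.

Lemma unit_ballP (Y : normedModType K) (y : Y) : unit_ball Y y <-> rnorm y <= 1.
Proof. by rewrite rnorm_le rmorph1. Qed.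

(** Forward, a finite subcover by small balls gives the colouring. Backward, an ultrafilter on the
    closure of the image concentrates near the image of one colour class at every scale, so it is
    Cauchy and converges by completeness. *)
Lemma compact_operatorsP (X : completeNormedModType K) (T : X -> X) :
  compact_operators X T <-> linear T /\ ball_totally_bounded T.
Proof.
split=> -[lT h]; split => //.
- case: h => U TU [+ _] t t0; rewrite compact_cover => cU.
  have t20 : 0 < ofR (t / 2) by rewrite -(rmorph0 ofR) ltr_ofR divr_gt0.
  have [x _|x Ux|D _ UD] := cU X setT (fun x => ball x (ofR (t / 2))).
  + exact: ball_open.
  + by exists x => //; exact: ballxx.
  pose s := finmap.enum_fset D.
  have sP y : rnorm y <= 1 -> has (fun x => `|x - T y| < ofR (t / 2)) s.
    move=> y1; have /UD[x /= Dx] : U (T y) by apply: TU; exists y => //; apply/unit_ballP.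
    by rewrite -ball_normE => xTy; apply/hasP; exists x.
  (* The colour of [y] is the index of the first ball of the subcover containing [T y]. *)
  exists 'I_(size s).+1, (fun y => inord (find (fun x => `|x - T y| < ofR (t / 2)) s)).
  move=> y y' /sP hy /sP hy' /(congr1 val) /=.
  rewrite !inordK ?ltnS ?find_size// => e.
  have := nth_find 0 hy; have := nth_find 0 hy'; rewrite -e -!rnorm_lt.
  set z := nth _ _ _; have := rdist_trans S z (T y) (T y').
  by rewrite (rdistC S (T y) z); lra.
- rewrite precompactE compact_ultra => F FU FA.
  have FC : cauchy F.
    apply/cauchy_exP => e /ofR_gt0_re[e0 eE].
    have e40 : 0 < re e / 4 by rewrite divr_gt0.
    have [k [col hcol]] := h _ e40.
    pose E c := [set z | exists y,
      [/\ rnorm y <= 1, col y = c & rnorm (z - T y) <= re e / 4]].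
    have [[c Fc]|noE] := pselect (exists c, F (E c)).
      have [z0 [y0 [y01 cy0 _]]] := filter_ex Fc.
      exists (T y0); apply: filterS Fc => z [y [y1 cy zy]].
      rewrite -ball_normE /ball_ /= -eE -rnorm_lt rdistC.
      apply: le_lt_trans (rdist_trans S (T y) _ _) _.
      have := hcol _ _ y1 y01; rewrite cy cy0 => /(_ erefl); lra.
    (* If no [E c] belongs to the ultrafilter, all their complements do, and so does the finite
       intersection of these; but every point of the closure lies in some [E c]. *)
    have FE : \forall z \near F, forall c, (~` E c) z.
      apply: filter_forall => c; have [Fc|//] := in_ultra_setVsetC (E c) FU.
      by case: noE; exists c.
    have [z [zE zA]] := filter_ex (filterI FE FA).
    exfalso; have [|w [[y yb <-]]] := zA (ball z (ofR (re e / 4))).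
      by apply: nbhsx_ballx; rewrite -(rmorph0 ofR) ltr_ofR.
    rewrite -ball_normE /ball_ /= -rnorm_lt => /ltW zTy; apply: (zE (col y)).
    by exists y; split => //; apply/unit_ballP.
  have PF : ProperFilter F by exact: ultra_proper.
  have Fl : cvg F := (@cauchy_cvgP X F PF).1 FC.
  exists (lim F); split => //.
  exact: (@closed_cvg _ _ F _ id _ (@closed_closure _ _) FA _ Fl).
Qed.

End Analysis.

(** * The operator norm, the space [l_1], and coordinates on [X] *)

Section Ell1Basis.
Context {R : realType} {K : numFieldType} (S : real_or_complex R K).
Local Notation re := (re S).
Local Notation ofR := (ofR S).
Local Notation rnorm := (rnorm S).
Local Notation functional := (functional S).

Lemma supremum_norm (I : Type) (D : set I) (V : normedZmodType K) (g : I -> V)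
    (C : R) : D !=set0 -> (forall p, D p -> rnorm (g p) <= C) ->
  exists s, [/\ supremum 0 [set `|g p| | p in D] = ofR s,
    forall p, D p -> rnorm (g p) <= s
    & forall c, (forall p, D p -> rnorm (g p) <= c) -> s <= c].
Proof.
move=> [p0 Dp0] gC; pose B := [set rnorm (g p) | p in D].
have B0 : B !=set0 by exists (rnorm (g p0)), p0.
have hsB : has_sup B by split => //; exists C => _ [p Dp <-]; exact: gC.
have leB p : D p -> rnorm (g p) <= sup B.
  by move=> Dp; apply: ub_le_sup hsB.2 _ _; exists p.
have Ble c : (forall p, D p -> rnorm (g p) <= c) -> sup B <= c.
  by move=> h; apply: ge_sup => // _ [p Dp <-]; exact: h.
exists (sup B); split => //.
set A := [set `|g p| | p in D].
have A0 : A !=set0 by exists `|g p0|, p0.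
have supA : supremums A (ofR (sup B)).
  split; first by move=> _ [p Dp <-]; rewrite -rnorm_le leB.
  move=> y yA.
  (* An upper bound in [K] exceeds a norm, hence is real and comparable with [sup B]. *)
  have yE : y = ofR (re (y - `|g p0|) + rnorm (g p0)).
    by rewrite rmorphD /= ofR_rnorm reK_ge0 ?subrK// subr_ge0; apply: yA; exists p0.
  rewrite yE ler_ofR; apply: Ble => p Dp; rewrite rnorm_le -yE.
  by apply: yA; exists p.
rewrite /supremum ifF; last by apply/negP => /eqP A00; case: A0 => a; rewrite A00.
by case: xgetP => [y _ /is_subset1_supremums|/(_ _ supA)//]; apply.
Qed.

Lemma opnormP (Y Z : normedModType K) (T : Y -> Z) (C : R) :
  linear T -> (forall x, rnorm (T x) <= C * rnorm x) ->
  exists c, [/\ opnorm T = ofR c, 0 <= c, forall x, rnorm (T x) <= c * rnorm x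
    & forall c', 0 <= c' -> (forall x, rnorm (T x) <= c' * rnorm x) -> c <= c'].
Proof.
move=> lT TC.
(* The absolute value covers a negative [C], possible when [Y] is trivial. *)
have [||c [cE Tc cle]] := @supremum_norm Y (unit_ball Y) Z T `|C|.
- by exists 0; apply/(unit_ballP S); rewrite rnorm0.
- move=> x /(unit_ballP S) x1; apply: le_trans (TC x) _.
  have := rnorm_ge0 S x; have := ler_norm C; have := normr_ge0 C; nra.
exists c; split => //.
- have := Tc 0; rewrite (linear_at0 lT) rnorm0; apply; apply/(unit_ballP S).
  by rewrite rnorm0.
- by apply: (linear_ball_bound lT) => x x1; apply: Tc; apply/(unit_ballP S).
- move=> c' c'0 Tc'; apply: cle => x /(unit_ballP S) x1.
  by apply: le_trans (Tc' x) _; rewrite ler_piMr.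
Qed.

Lemma functional_opnorm (X : normedModType K) (f : X -> K^o) : functional f ->
  exists c, [/\ opnorm f = ofR c, 0 <= c, forall x, rnorm (f x) <= c * rnorm x
    & forall c', 0 <= c' -> (forall x, rnorm (f x) <= c' * rnorm x) -> c <= c'].
Proof. by move=> [lf [C C0 fC]]; exact: opnormP fC. Qed.

Lemma normed_seriesE (a : nat -> K^o) n :
  ([normed series a] : nat -> K) n = ofR (\sum_(j < n) rnorm (a j)).
Proof.
rewrite /= /series /= big_mkord rmorph_sum.
by apply: eq_bigr => j _; rewrite ofR_rnorm.
Qed.

Lemma ell1P (a : nat -> K^o) : ell1 a ->
  exists L, [/\ ell1_norm a = ofR L, forall n, \sum_(j < n) rnorm (a j) <= L
    & forall t, 0 < t -> exists N, forall n, (N <= n)%N ->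
        L - \sum_(j < n) rnorm (a j) <= t].
Proof.
rewrite /ell1 /= => cva; set u := ([normed series a] : nat -> K) in cva.
have cvg_u := (@cvgn_rnormP R K S K^o u (ell1_norm a)).1 cva.
set l := ell1_norm a in cvg_u *.
pose s n := \sum_(j < n) rnorm (a j).
have uE n : u n = ofR (s n) := normed_seriesE a n.
have s_mono n m : (n <= m)%N -> s n <= s m.
  move=> /subnKC <-; rewrite /s big_split_ord /= lerDl.
  by apply: sumr_ge0 => i _; exact: rnorm_ge0.
have near_s (t : R) : 0 < t -> exists N, forall n, (N <= n)%N -> `|re l - s n| <= t.
  move=> /cvg_u[N hN]; exists N => n /hN; rewrite uE => h.
  rewrite ler_norml; have := re_le_rnorm S (l - ofR (s n)).
  have := re_le_rnorm S (- (l - ofR (s n))); rewrite rnormN reN reB re_ofR.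
  by lra.
have s_le n : s n <= re l.
  apply: ler_addeps => t /near_s[N hN].
  have := hN (N + n)%N (leq_addr _ _); have := s_mono _ _ (leq_addl N n).
  rewrite ler_norml => h /andP[]; lra.
exists (re l); split => //.
- apply/eqP; rewrite -subr_eq0; apply/eqP; apply: (rnorm_eq0 (S := S)).
  apply/eqP; rewrite eq_le rnorm_ge0 andbT; apply: ler_addeps => t t0.
  have t20 : 0 < t / 2 by rewrite divr_gt0.
  have [N hN] := cvg_u _ t20; have [M hM] := near_s _ t20.
  have h1 := hN _ (leq_addr M N); have h2 := hM _ (leq_addl N M).
  rewrite add0r; apply: le_trans (rdist_trans S (u (N + M)%N) _ _) _.
  rewrite [leRHS]splitr; apply: lerD => //.
  rewrite rdistC uE -rmorphB rnorm_ofR ?subr_ge0//.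
  by move: h2; rewrite ger0_norm ?subr_ge0.
- move=> t /near_s[N hN]; exists N => n /hN.
  by rewrite ger0_norm ?subr_ge0.
Qed.

Lemma ell1_normE (a : nat -> K^o) (L : R) :
  (forall t, 0 < t -> exists N, forall n, (N <= n)%N ->
     `|L - \sum_(j < n) rnorm (a j)| <= t) ->
  ell1 a /\ ell1_norm a = ofR L.
Proof.
move=> h; have cv : (([normed series a] : nat -> K) : nat -> K^o) @ \oo --> (ofR L : K^o).
  apply/(cvgn_rnormP S) => t /h[N hN]; exists N => n /hN.
  rewrite normed_seriesE -rmorphB /= => hn.
  by rewrite (rnorm_ofR_abs S (_ - _)).
by split; [apply/cvg_ex; exists (ofR L : K^o) | exact: cvg_lim cv].
Qed.

(** The form in which the isometry is used: [e j] corresponds to the unit vector [j] of [l_1], and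
    [coef f] is the sequence of [f]. The last two fields say that this sequence has [l_1] norm at
    most that of [f], and that the expansion of [f] converges in norm. *)
Record ell1_basis (X : normedModType K) (e : nat -> X -> K)
    (coef : (X -> K) -> nat -> K) : Prop := Ell1Basis {
  basis_linear : forall j a x y, e j (a *: x + y) = a * e j x + e j y;
  basis_le : forall j x, rnorm (e j x) <= rnorm x;
  coef_linear : forall a f g j, functional f -> functional g ->
    coef (fun x => a * f x + g x) j = a * coef f j + coef g j;
  coef_basis : forall i j, coef (e i) j = (i == j)%:R;
  coef_sum_le : forall f C n, functional f -> 0 <= C ->
    (forall x, rnorm (f x) <= C * rnorm x) ->
    \sum_(j < n) rnorm (coef f j) <= C;
  coef_expand : forall f t, functional f -> 0 < t ->
    exists N, forall n, (N <= n)%N -> forall x,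
      rnorm (f x - \sum_(j < n) coef f j * e j x) <= t * rnorm x }.

Lemma functional_lin (X : normedModType K) a (f g : X -> K) :
  functional f -> functional g -> functional (fun x => a * f x + g x).
Proof.
move=> [lf [C C0 fC]] [lg [D D0 gD]]; split.
  by move=> b x y; rewrite lf lg; ring.
exists (rnorm a * C + D) => [|x]; first by rewrite addr_ge0 ?mulr_ge0 ?rnorm_ge0.
apply: le_trans (rnormD S _ _) _; rewrite rnormM mulrDl lerD// -mulrA.
by rewrite ler_wpM2l ?rnorm_ge0.
Qed.

Lemma functional0 (X : normedModType K) : functional (fun _ : X => 0).
Proof.
split=> [a x y|]; first by rewrite mulr0 addr0.
by exists 0 => // x; rewrite rnorm0 mul0r.
Qed.

Lemma functional_sum (X : normedModType K) (I : Type) (r : seq I) (a : I -> K)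
    (f : I -> X -> K) : (forall i, functional (f i)) ->
  functional (fun x => \sum_(i <- r) a i * f i x).
Proof.
move=> hf; elim: r => [|i r IH].
  by under eq_fun do rewrite big_nil; exact: functional0.
by under eq_fun do rewrite big_cons; exact: functional_lin.
Qed.

(** [coef] is the isometry itself and [e j] a preimage of a unit vector. The expansion converges
    because the remainder of [f] corresponds to a tail of its sequence, whose [l_1] norm tends to
    zero. *)
Lemma dual_isometric_ell1_basis (X : normedModType K) :
  dual_isometric_ell1 X -> exists e coef, @ell1_basis X e coef.
Proof.
move=> [Phi [Phi_lin [Phi_ell1 _ Phi_surj] Phi_norm]].
pose delta (j : nat) : nat -> K^o := fun k => (j == k)%:R.
have delta_sum j n : \sum_(k < n) rnorm (delta j k) = (j < n)%N%:R :> R.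
  elim: n => [|n IH]; first by rewrite big_ord0.
  rewrite big_ord_recr /= IH ltnS /delta.
  by case: ltngtP => _ /=; rewrite ?rnorm0 ?rnorm1 ?addr0 ?add0r.
have delta_norm j : ell1 (delta j) /\ ell1_norm (delta j) = ofR 1.
  apply: ell1_normE => t t0; exists j.+1 => n jn.
  by rewrite delta_sum jn subrr normr0 ltW.
pose e j : X -> K := sval (cid2 (Phi_surj _ (delta_norm j).1)).
have e_dual j : dual X (e j) by rewrite /e; case: cid2.
have e_fun j : functional (e j) by apply/dualP.
have Phi_e j : Phi (e j) = delta j by rewrite /e; case: cid2.
have e_le j x : rnorm (e j x) <= rnorm x.
  have [c [ec c0 ecx _]] := functional_opnorm (e_fun j).
  have : ofR c = ofR 1 by rewrite -ec -(delta_norm j).2 -Phi_e Phi_norm.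
  by move=> /fmorph_inj c1; have := ecx x; rewrite c1 mul1r.
have fun0 := functional0 X.
have Phi_linx a (f g : X -> K) j : functional f -> functional g ->
    Phi (fun x => a * f x + g x) j = a * Phi f j + Phi g j.
  by move=> /(dualP S) df /(dualP S) dg; have := Phi_lin a _ _ df dg => /(congr1 (@^~ j)).
have Phi0 j : Phi (fun _ : X => 0 : K) j = 0.
  transitivity (Phi (fun _ : X => (-1) * 0 + 0 : K) j).
    by congr (Phi _ j); apply/funext => x; rewrite mulr0 addr0.
  by rewrite (Phi_linx (-1) _ _ j fun0 fun0) mulN1r addNr.
have Phi_sum (a : nat -> K) n j :
    Phi (fun x => \sum_(i < n) a i * e i x) j = if (j < n)%N then a j else 0.
  elim: n => [|n IH]; first by under eq_fun do rewrite big_ord0; rewrite Phi0.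
  under [X in Phi X]eq_fun do rewrite big_ord_recr /= addrC.
  rewrite Phi_linx//; last exact: functional_sum.
  rewrite IH Phi_e /delta ltnS; case: ltngtP => jn; rewrite ?mulr0 ?add0r//.
  by rewrite mulr1 addr0 jn.
exists e, Phi; split => //.
- by move=> j a x y; rewrite (e_fun j).1.
- by move=> i j; rewrite Phi_e.
- move=> f C n ff C0 fC; have [c [fc c0 _ cmin]] := functional_opnorm ff.
  have df := (dualP S f).2 ff; have [L [LE sL _]] := ell1P (Phi_ell1 _ df).
  apply: le_trans (sL n) _; have := Phi_norm _ df; rewrite LE fc => /fmorph_inj ->.
  exact: cmin.
- move=> f t ff t0; have df := (dualP S f).2 ff.
  have [L [LE sL hL]] := ell1P (Phi_ell1 _ df).
  have [N hN] := hL t t0; exists N => n /hN Lt x.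
  pose g x := (-1) * (\sum_(j < n) Phi f j * e j x) + f x.
  have fg : functional g by apply: functional_lin => //; exact: functional_sum.
  have PhigE j : Phi g j = if (j < n)%N then 0 else Phi f j.
    rewrite Phi_linx//; last exact: functional_sum.
    by rewrite Phi_sum; case: ifP => _; rewrite mulN1r ?addNr ?oppr0 ?add0r.
  have tail m : (n <= m)%N -> \sum_(j < m) rnorm (Phi g j) =
      \sum_(j < m) rnorm (Phi f j) - \sum_(j < n) rnorm (Phi f j).
    move=> /subnKC <-; rewrite !big_split_ord /= addrAC subrr add0r.
    rewrite big1 ?add0r => [|i _]; last by rewrite PhigE ltn_ord rnorm0.
    by apply: eq_bigr => i _; rewrite PhigE ltnNge leq_addr.
  have [_ gE] : ell1 (Phi g) /\ ell1_norm (Phi g)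
      = ofR (L - \sum_(j < n) rnorm (Phi f j)).
    apply: ell1_normE => r /hL[M hM]; exists (maxn n M) => m.
    rewrite geq_max => /andP[nm Mm]; rewrite tail// opprB addrA subrK.
    by rewrite ger0_norm ?subr_ge0// hM.
  have [c [gc c0 gcx _]] := functional_opnorm fg.
  have := Phi_norm _ ((dualP S g).2 fg); rewrite gE gc => /fmorph_inj cE.
  have -> : f x - \sum_(j < n) Phi f j * e j x = g x by rewrite /g mulN1r addrC.
  by apply: le_trans (gcx x) _; rewrite -cE ler_wpM2r ?rnorm_ge0.
Qed.
Section Coordinates.
Context {X : normedModType K} {e : nat -> X -> K} {coef : (X -> K) -> nat -> K}.
Context (eB : ell1_basis e coef).

Lemma functional_basis j : functional (e j).
Proof.
split=> [a x y|]; first exact: (basis_linear eB).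
by exists 1 => // x; rewrite mul1r (basis_le eB).
Qed.

Lemma coef_fun0 j : coef (fun _ => 0) j = 0.
Proof.
transitivity (coef (fun _ : X => (-1) * 0 + 0) j).
  by congr (coef _ j); apply/funext => x; rewrite mulr0 addr0.
have f0 := functional0 X.
by rewrite (coef_linear eB (-1) j f0 f0) mulN1r addNr.
Qed.

Lemma coef_lin_sum (I : Type) (r : seq I) (a : I -> K) (f : I -> X -> K) j :
  (forall i, functional (f i)) ->
  coef (fun x => \sum_(i <- r) a i * f i x) j = \sum_(i <- r) a i * coef (f i) j.
Proof.
move=> hf; elim: r => [|i r IH].
  rewrite big_nil -[RHS](coef_fun0 j); congr (coef _ j).
  by apply/funext => x; rewrite big_nil.
rewrite big_cons -IH -(coef_linear eB _ j (hf i) (functional_sum _ _ hf)).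
by congr (coef _ j); apply/funext => x; rewrite big_cons.
Qed.

Lemma coef_expand_at f x (t : R) : functional f -> 0 < t ->
  exists N, forall n, (N <= n)%N ->
    rnorm (f x - \sum_(j < n) coef f j * e j x) <= t.
Proof.
move=> ff t0; have xp : 0 < rnorm x + 1 by have := rnorm_ge0 S x; lra.
have [|N hN] := @coef_expand _ _ _ eB f (t / (rnorm x + 1)) ff.
  by rewrite divr_gt0.
exists N => n /hN/(_ x)/le_trans; apply.
by rewrite mulrAC ler_pdivrMr// ler_wpM2l ?(ltW t0)// lerDl.
Qed.

Lemma functional_le_sup f (C r : R) x : functional f -> 0 <= C ->
  (forall y, rnorm (f y) <= C * rnorm y) -> (forall j, rnorm (e j x) <= r) ->
  rnorm (f x) <= C * r.
Proof.
move=> ff C0 fC er; apply: ler_addeps => t t0.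
have [N /(_ N (leqnn _))] := coef_expand_at x ff t0.
set s := \sum_(j < N) _ => ft.
have -> : f x = s + (f x - s) by rewrite addrC subrK.
apply: le_trans (rnormD S _ _) _; apply: lerD => //.
apply: le_trans (rnorm_sum S _ _ _) _.
apply: le_trans (_ : (\sum_(j < N) rnorm (coef f j)) * r <= _).
  rewrite mulr_suml; apply: ler_sum => j _.
  by rewrite rnormM ler_wpM2l ?rnorm_ge0.
apply: ler_wpM2r; last exact: coef_sum_le eB _ _ _ ff C0 fC.
exact: le_trans (rnorm_ge0 S _) (er 0%N).
Qed.

(** Thus the coordinates embed [X] isometrically into [l_infty]. A Hahn-Banach functional norming
    [x] has coefficients of total mass at most its norm, so its value at [x] is controlled by the
    coordinates of [x]. *)
Lemma rnorm_le_sup r x : (forall j, rnorm (e j x) <= r) -> rnorm x <= r.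
Proof.
move=> er; have r0 := le_trans (rnorm_ge0 S _) (er 0%N).
have [->//|xn0] := eqVneq (rnorm x) 0.
have xp : 0 < rnorm x by rewrite lt_neqAle eq_sym xn0 rnorm_ge0.
have [|||v|s /=|phi [philin phile phix]] :=
    @hahn_banach_gauge R K S X (fun s v => rnorm v <= s * rnorm x) x.
- move=> s v /(le_trans (rnorm_ge0 S v)).
  by rewrite pmulr_lge0.
- move=> s u t v Ps Pt; apply: le_trans (rnormD S _ _) _.
  by rewrite mulrDl lerD.
- by move=> a s v Ps; rewrite rnormZ -mulrA ler_wpM2l ?rnorm_ge0.
- by exists (rnorm v / rnorm x); rewrite divfK.
- by rewrite -{1}[rnorm x]mul1r ler_pM2r.
have phiC y : rnorm (phi y) <= (rnorm x)^-1 * rnorm y.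
  by apply: phile; rewrite mulrAC mulVf// mul1r.
have iC : 0 <= (rnorm x)^-1 by rewrite invr_ge0 rnorm_ge0.
have fphi : functional phi by split => //; exists (rnorm x)^-1.
have := functional_le_sup fphi iC phiC er.
move=> /(le_trans (re_le_rnorm S _))/(le_trans phix).
by rewrite mulrC ler_pdivlMr// mul1r.
Qed.

End Coordinates.

End Ell1Basis.

(** * Local reflexivity: finite systems of norm constraints *)

Section LocalReflexivity.
Context {R : realType} {K : numFieldType} (S : real_or_complex R K).
Context {X : normedModType K} {e : nat -> X -> K} {coef : (X -> K) -> nat -> K}.
Context (eB : ell1_basis S e coef).
Local Notation re := (re S).
Local Notation ofR := (ofR S).
Local Notation rnorm := (rnorm S).
Local Notation functional := (functional S).

Definition single (C : eqType) (W : lmodType K) (c : C) (x : W) : C -> W :=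
  fun c' => if c' == c then x else 0.

Lemma single_lin (C : eqType) (W : lmodType K) (c : C) a (x y : W) :
  single c (a *: x + y) = a *: single c x + single c y.
Proof.
apply/funext => c'; rewrite /single.
transitivity (a *: (if c' == c then x else 0) + (if c' == c then y else 0)) => //.
by case: ifP => // _; rewrite scaler0 addr0.
Qed.

Lemma linear_fun_decomp (C : finType) (W : lmodType K) (L : (C -> W) -> K) :
  (forall a u v, L (a *: u + v) = a * L u + L v) ->
  forall f, L f = \sum_c L (single c (f c)).
Proof.
move=> Llin f.
have L0 : L 0 = 0 := linear_at0 (Llin : linear (L : _ -> K^o)).
have LD u v : L (u + v) = L u + L v by rewrite -[u]scale1r Llin mul1r scale1r.
rewrite -(big_morph L LD L0); congr L; rewrite fct_sumE; apply/funext => c.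
rewrite /single (bigD1 c)//= eqxx big1 ?addr0// => c' /negPf.
by rewrite eq_sym => ->.
Qed.

Lemma functional_attained (f : X -> K) : functional f ->
  exists b, [/\ 0 <= b, forall x, rnorm (f x) <= b * rnorm x &
    forall t : R, 0 < t -> exists2 x, rnorm x <= 1 & b - t <= re (f x)].
Proof.
move=> ff; have [b [_ b0 fb bmin]] := functional_opnorm ff.
have f0 : f 0 = 0 := linear_at0 (ff.1 : linear (f : X -> K^o)).
exists b; split => // t t0.
have [bt|tb] := leP b t.
  by exists 0; rewrite ?rnorm0// f0 re0; lra.
apply: contrapT => nx.
have : b <= b - t.
  apply: bmin => [|x]; first lra.
  have [x0|xn0] := eqVneq (rnorm x) 0.
    by rewrite (rnorm_eq0 x0) f0 !rnorm0 mulr0.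
  have xp : 0 < rnorm x by rewrite lt_neqAle eq_sym xn0 rnorm_ge0.
  rewrite leNgt; apply/negP => fx; apply: nx.
  have [z z1 zf] := phase S (f x).
  exists ((z * ofR (rnorm x)^-1) *: x).
    by rewrite rnormZ rnormM z1 rnorm_ofR ?invr_ge0 ?rnorm_ge0// mul1r mulVf.
  rewrite -[_ *: x]addr0 ff.1 f0 addr0 [z * _]mulrC -mulrA zf.
  by rewrite -rmorphM re_ofR mulrC ler_pdivlMr// ltW.
by lra.
Qed.

(** Duality of finite weighted [l_infty] and [l_1] sums: points nearly norming the different [psi c]
    can be chosen independently, so the norms add up. *)
Lemma functional_family_bound (C : finType) (psi : C -> X -> K) (rho : C -> R) :
  (forall c, functional (psi c)) -> (forall c, 0 <= rho c) ->
  (forall x : C -> X, (forall c, rnorm (x c) <= 1) ->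
     \sum_c rho c * re (psi c (x c)) <= 1) ->
  exists b : C -> R, [/\ forall c, 0 <= b c,
    forall c x, rnorm (psi c x) <= b c * rnorm x & \sum_c rho c * b c <= 1].
Proof.
move=> fpsi rho0 hx.
have /choice[b hb] c := functional_attained (fpsi c).
exists b; split=> [c|c|]; [by case: (hb c)|by case: (hb c)|].
apply: ler_addeps => t t0.
have sp : 0 < \sum_c rho c + 1.
  by rewrite ltr_pwDr// sumr_ge0.
have tp : 0 < t / (\sum_c rho c + 1) by rewrite divr_gt0.
have /choice[x xb] c : exists x, rnorm x <= 1 /\
    b c - t / (\sum_c rho c + 1) <= re (psi c x).
  by have [_ _ /(_ _ tp)[x x1 xb]] := hb c; exists x.
have /hx h1 c : rnorm (x c) <= 1 := (xb c).1.
rewrite -lerBlDr; apply: le_trans h1.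
apply: le_trans (_ : \sum_c rho c * (b c - t / (\sum_c rho c + 1)) <= _).
  under [leRHS]eq_bigr do rewrite mulrBr.
  rewrite sumrB lerB// -mulr_suml mulrCA ler_piMr ?(ltW t0)//.
  by rewrite ler_pdivrMr// mul1r lerDl.
by apply: ler_sum => c _; rewrite ler_wpM2l//; case: (xb c).
Qed.

(* [om] is a family in the bidual [l_infty].  If no [w] exists, Hahn-Banach
   yields functionals [psi c] and scalars [h i j] whose [l_1]-coefficients
   contradict the constraints on [om], coordinate by coordinate. *)
Lemma local_reflexivity (C I : finType) (p : C -> X) (M : C -> I -> K)
    (r : C -> R) (om : I -> nat -> K) (m : nat) (t : R) :
  (forall c, 0 < r c) -> 0 < t ->
  (forall c j, rnorm (e j (p c) + \sum_i M c i * om i j) <= r c) ->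
  exists w : I -> X,
    (forall c, rnorm (p c + \sum_i M c i *: w i) <= (1 + t) * r c) /\
    (forall i (j : 'I_m), rnorm (e j (w i) - om i j) <= t).
Proof.
move=> r0 t0 hom; apply: contrapT => now.
have e_lin j : linear (e j : X -> K^o) := basis_linear eB j.
have e0 j : e j 0 = 0 := linear_at0 (e_lin j).
have eZ j a x : e j (a *: x) = a * e j x := linear_scale a x (e_lin j).
have tr0 c : 0 < (1 + t) * r c by rewrite mulr_gt0// addr_gt0.
pose V : lmodType K := ((C -> X) * (I -> 'I_m -> K^o))%type.
(* The gauge of [v] measures how small [v] can be made, relative to the constraint balls, by adding
   the image of some [w] under the constraint map. A gauge of [v0] below [1] would produce the
   desired [w]. *)
pose Pw (s : R) (v : V) (w : I -> X) :=
  (forall c, rnorm (v.1 c + \sum_i M c i *: w i) <= s * ((1 + t) * r c)) /\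
  (forall i (j : 'I_m), rnorm (v.2 i j + e j (w i) : K) <= s * t).
pose P (s : R) (v : V) := 0 <= s /\ exists w, Pw s v w.
pose v0 : V := (p, fun i (j : 'I_m) => - om i j : K^o).
have [|||v|s /= [s0 [w [w1 w2]]]|phi [philin phile phi1]] :=
  @hahn_banach_gauge R K S V P v0.
- by move=> s v [].
- move=> s u s' v [s0 [w [w1 w2]]] [s'0 [w' [w'1 w'2]]].
  split; [exact: addr_ge0|exists (w \+ w'); split=> [c|i j] /=].
    under eq_bigr do rewrite scalerDr.
    rewrite big_split /= addrACA; apply: le_trans (rnormD S _ _) _.
    by rewrite mulrDl lerD.
  rewrite -[w i]scale1r (basis_linear eB) mul1r addrACA.
  by apply: le_trans (rnormD S _ _) _; rewrite mulrDl lerD.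
- move=> a s v [s0 [w [w1 w2]]]; split; first by rewrite mulr_ge0 ?rnorm_ge0.
  exists (fun i => a *: w i); split=> [c|i j] /=.
    under eq_bigr do rewrite scalerA mulrC -scalerA.
    by rewrite -scaler_sumr -scalerDr rnormZ -mulrA ler_wpM2l ?rnorm_ge0.
  by rewrite eZ -mulrDr rnormM -mulrA ler_wpM2l ?rnorm_ge0.
- pose s1 : R := \sum_c rnorm (v.1 c) / ((1 + t) * r c).
  pose s2 : R := \sum_i \sum_(j < m) rnorm (v.2 i j : K) / t.
  have s1_ge0 : 0 <= s1.
    by apply: sumr_ge0 => c _; rewrite divr_ge0 ?rnorm_ge0 ?ltW ?tr0.
  have s2_ge0 : 0 <= s2.
    by do 2 apply: sumr_ge0 => ? _; rewrite divr_ge0 ?rnorm_ge0 ?ltW.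
  exists (s1 + s2); split; first exact: addr_ge0.
  exists (fun _ => 0); split=> [c|i j].
    rewrite big1 ?addr0 => [|i _]; last by rewrite scaler0.
    rewrite -ler_pdivrMr ?tr0//; apply: (@le_trans _ _ s1); last by rewrite lerDl.
    rewrite /s1 (bigD1 c)//= lerDl.
    by apply: sumr_ge0 => ? _; rewrite divr_ge0 ?rnorm_ge0 ?ltW ?tr0.
  rewrite e0 addr0 -ler_pdivrMr//; apply: (@le_trans _ _ s2); last by rewrite lerDr.
  rewrite /s2 (bigD1 i)//= (bigD1 j)//=.
  apply: (@le_trans _ _ (rnorm (v.2 i j : K) / t +
    \sum_(k < m | k != j) rnorm (v.2 i k : K) / t)).
    by rewrite lerDl; apply: sumr_ge0 => ? _; rewrite divr_ge0 ?rnorm_ge0 ?ltW.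
  by rewrite lerDl; do 2 apply: sumr_ge0 => ? _; rewrite divr_ge0 ?rnorm_ge0 ?ltW.
- rewrite leNgt; apply/negP => s_lt1; apply: now; exists w; split=> [c|i j].
    by apply: le_trans (w1 c) _; rewrite ler_piMl ?ltW ?tr0.
  rewrite addrC; apply: le_trans (w2 i j) _.
  by rewrite ler_piMl ?ltW.
have phi1lin (a : K) (u v : C -> X) : phi (a *: u + v, 0) = a * phi (u, 0) + phi (v, 0).
  by rewrite -philin; congr phi; apply: injective_projections; rewrite /= ?scaler0 ?addr0.
have phi2lin (a : K) (u v : I -> 'I_m -> K^o) :
    phi (0, a *: u + v) = a * phi (0, u) + phi (0, v).
  by rewrite -philin; congr phi; apply: injective_projections; rewrite /= ?scaler0 ?addr0.
pose psi c x := phi (single c x, 0).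
pose h i (j : 'I_m) := phi (0, single i (single j (1 : K^o))).
have phiE f g : phi (f, g) = \sum_c psi c (f c) + \sum_i \sum_j h i j * g i j.
  have -> : phi (f, g) = phi (f, 0) + phi (0, g).
    by rewrite -[phi (f, 0)]mul1r -philin; congr phi;
      apply: injective_projections; rewrite /= scale1r ?addr0 ?add0r.
  rewrite (linear_fun_decomp phi1lin) (linear_fun_decomp phi2lin); congr (_ + _).
  apply: eq_bigr => i _.
  pose L (k : 'I_m -> K^o) := phi (0, single i k).
  have Llin (a : K) (u v : 'I_m -> K^o) : L (a *: u + v) = a * L u + L v.
    by rewrite /L single_lin phi2lin.
  rewrite -/(L (g i)) (linear_fun_decomp Llin); apply: eq_bigr => j _.
  have L0 : L 0 = 0 := linear_at0 (Llin : linear (L : _ -> K^o)).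
  have -> : single j (g i j) = g i j *: single j (1 : K^o) + 0.
    rewrite -[0 in RHS](_ : single j (0 : K^o) = _) -?single_lin ?addr0.
      by congr single; rewrite -[LHS]mulr1.
    by apply/funext => j'; rewrite /single; case: ifP.
  by rewrite Llin L0 addr0 mulrC.
have psi_lin c a x y : psi c (a *: x + y) = a * psi c x + psi c y.
  by rewrite /psi single_lin phi1lin.
have psiZ c a x : psi c (a *: x) = a * psi c x.
  exact: (linear_scale a x (psi_lin c : linear (psi c : X -> K^o))).
have psi_fun c : functional (psi c).
  split; first exact: psi_lin.
  exists ((1 + t) * r c)^-1 => [|x]; first by rewrite invr_ge0 ltW.
  have s_ge0 : 0 <= ((1 + t) * r c)^-1 * rnorm x.
    by rewrite mulr_ge0 ?rnorm_ge0// invr_ge0 ltW.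
  apply: phile; split => //; exists (fun _ => 0); split=> [c'|i j] /=.
    rewrite big1 ?addr0 => [|i _]; last by rewrite scaler0.
    rewrite /single; have [->|_] := eqVneq; first by rewrite mulrAC mulVf ?mul1r// gt_eqF.
    by rewrite rnorm0 mulr_ge0// ltW.
  by rewrite e0 addr0 rnorm0 mulr_ge0// ltW.
(* [phi] vanishes on the image of the constraint map, since such a vector is cancelled by a suitable
   [w] and has gauge zero. *)
have relation i x : \sum_c M c i * psi c x + \sum_j h i j * e j x = 0.
  pose f c := M c i *: x; pose g i' (j : 'I_m) : K^o := if i' == i then e j x else 0.
  have : phi (f, g) = 0.
    apply: (rnorm_eq0 (S := S)); apply/eqP; rewrite eq_le rnorm_ge0 andbT.
    apply: phile; split => //; exists (fun i' => if i' == i then - x else 0).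
    split=> [c|i' j] /=; rewrite mul0r.
      rewrite (bigD1 i)//= eqxx big1 => [|i' /negPf ->]; last by rewrite scaler0.
      by rewrite addr0 /f scalerN subrr rnorm0.
    rewrite /g; case: ifP => _; last by rewrite e0 addr0 rnorm0.
    by rewrite -scaleN1r eZ mulN1r subrr rnorm0.
  rewrite phiE => fg0; rewrite -[RHS]fg0; congr (_ + _).
    by apply: eq_bigr => c _; rewrite psiZ.
  rewrite [RHS](bigD1 i)//= [X in _ = _ + X]big1 => [|i' /negPf i'i]; last first.
    by rewrite big1// => j _; rewrite /g i'i mulr0.
  by rewrite addr0; apply: eq_bigr => j _; rewrite /g eqxx.
have tr_ge0 c : 0 <= (1 + t) * r c := ltW (tr0 c).
have [|b [b0 psib bsum]] := functional_family_bound psi_fun tr_ge0.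
  move=> x x1; have {1}-> : \sum_c (1 + t) * r c * re (psi c (x c)) =
      re (phi (fun c => ofR ((1 + t) * r c) *: x c, 0)).
    have z0 : \sum_i \sum_j h i j * (0 : I -> 'I_m -> K^o) i j = 0.
      by rewrite big1// => i _; rewrite big1// => j _; rewrite mulr0.
    rewrite phiE z0 addr0.
    by rewrite re_sum; apply: eq_bigr => c _; rewrite psiZ re_ofRM.
  apply: le_trans (re_le_rnorm _ _) _; apply: phile; split => //.
  exists (fun _ => 0); split=> [c|i j] /=; rewrite mul1r.
    rewrite big1 ?addr0 => [|i _]; last by rewrite scaler0.
    by rewrite rnormZ rnorm_ofR// ler_piMr.
  by rewrite e0 addr0 rnorm0 ltW.
pose a c k := coef (psi c) k.
have coef_rel i k : \sum_c M c i * a c k + \sum_(j < m) h i j * (val j == k)%:R = 0.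
  have ef j : functional (e j) := functional_basis eB j.
  rewrite -[RHS](coef_fun0 eB k) -(coef_lin_sum eB _ _ k psi_fun).
  under [X in _ + X]eq_bigr do rewrite -(coef_basis eB).
  rewrite -(coef_lin_sum eB _ _ k (fun j : 'I_m => ef j)) -[X in X + _]mul1r.
  rewrite -(coef_linear eB); [|exact: functional_sum..].
  by congr coef; apply/funext => x; rewrite mul1r relation.
(* The contradiction: [phi v0] has real part at least [1], whereas the constraints on [om] bound its
   modulus by [(1 + t)^-1] up to any [d]. *)
suff : 1 <= (1 + t)^-1.
  by rewrite -[leRHS]mul1r ler_pdivlMr ?mul1r; lra.
apply: ler_addeps => d d0.
pose d' := d / (#|C|%:R + 1).
have d'0 : 0 < d' by rewrite divr_gt0// ltr_wpDl.
have /choice[N hN] c := coef_expand_at eB (p c) (psi_fun c) d'0.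
pose n := maxn m (\max_c N c).
have Nn c : (N c <= n)%N by rewrite leq_max leq_bigmax orbT.
pose T := \sum_(k < n) \sum_c a c k * (e k (p c) + \sum_i M c i * om i k).
(* By [coef_rel] the sums over [c] of [M c i * a c k] vanish for [k >= m], so the finitely many
   [h i j] can be traded for the coefficients of all [psi c] up to [n]. *)
have homE : \sum_i \sum_(j < m) h i j * om i j =
    - \sum_(k < n) \sum_c a c k * (\sum_i M c i * om i k).
  have -> : \sum_i \sum_(j < m) h i j * om i j =
      \sum_i \sum_(k < n) (\sum_(j < m) h i j * (val j == k)%:R) * om i k.
    apply: eq_bigr => i _; under [RHS]eq_bigr do rewrite mulr_suml.
    rewrite exchange_big /=; apply: eq_bigr => j _.
    have jn : (j < n)%N by apply: leq_trans (ltn_ord j) _; exact: leq_maxl.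
    rewrite (bigD1 (Ordinal jn))//= eqxx mulr1 big1 ?addr0// => k.
    by rewrite -val_eqE /= eq_sym => /negPf ->; rewrite mulr0 mul0r.
  rewrite exchange_big /= -sumrN; apply: eq_bigr => k _.
  under [X in - X]eq_bigr do rewrite mulr_sumr.
  rewrite exchange_big /= -sumrN; apply: eq_bigr => i _.
  have := coef_rel i k; rewrite addrC => /eqP; rewrite addr_eq0 => /eqP ->.
  rewrite mulNr mulr_suml; congr (- _); apply: eq_bigr => c _; ring.
have phi_v0 : phi v0 =
    \sum_c (psi c (p c) - \sum_(k < n) a c k * e k (p c)) + T.
  rewrite /v0 phiE.
  under [X in _ + X]eq_bigr do under eq_bigr do rewrite mulrN.
  under [X in _ + X]eq_bigr do rewrite sumrN.
  rewrite sumrN homE opprK sumrB /T.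
  under [X in _ = _ + X]eq_bigr do (under eq_bigr do rewrite mulrDr; rewrite big_split /=).
  rewrite big_split /= [X in _ = _ - X + _]exchange_big /=; ring.
(* Each constraint on [om] bounds a term by [r c * rnorm (a c k)]; the sum over [k] is at most
   [r c * b c], and [bsum] gains the factor [(1 + t)^-1]. *)
have T_le : rnorm T <= (1 + t)^-1.
  apply: le_trans (rnorm_sum S _ _ _) _.
  apply: le_trans (_ : \sum_c r c * b c <= _); last first.
    rewrite -[leRHS]mul1r ler_pdivlMr; last by lra.
    rewrite mulr_suml; apply: le_trans bsum; apply: ler_sum => c _.
    by rewrite mulrC mulrA.
  apply: le_trans (_ : \sum_(k < n) \sum_c r c * rnorm (a c k) <= _).
    apply: ler_sum => k _; apply: le_trans (rnorm_sum S _ _ _) _.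
    apply: ler_sum => c _; rewrite rnormM mulrC ler_wpM2r ?rnorm_ge0//.
  rewrite exchange_big /=; apply: ler_sum => c _; rewrite -mulr_sumr.
  rewrite ler_wpM2l ?(ltW (r0 c))//.
  exact: coef_sum_le eB _ _ _ (psi_fun c) (b0 c) (psib c).
apply: le_trans phi1 _; apply: le_trans (re_le_rnorm S _) _.
rewrite phi_v0; apply: le_trans (rnormD S _ _) _; rewrite addrC lerD//.
apply: le_trans (rnorm_sum S _ _ _) _.
apply: le_trans (_ : \sum_(c : C) d' <= _).
  by apply: ler_sum => c _; exact: hN.
rewrite sumr_const -mulr_natl /d' mulrCA ler_piMr ?(ltW d0)//.
by rewrite ler_pdivrMr ?mul1r ?lerDl// ltr_wpDl.
Qed.

End LocalReflexivity.

(** * Colourings and finite nets for several maps at once *)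

Section TotallyBounded.
Context {R : realType} {K : numFieldType} (S : real_or_complex R K).
Local Notation re := (re S).
Local Notation ofR := (ofR S).
Local Notation rnorm := (rnorm S).
Local Notation functional := (functional S).
Local Notation ball_totally_bounded := (ball_totally_bounded S).

Lemma totally_bounded_functional (Y : normedModType K) (f : Y -> K) (t : R) :
  functional f -> 0 < t -> exists (k : finType) (col : Y -> k),
  forall y y', rnorm y <= 1 -> rnorm y' <= 1 -> col y = col y' ->
    rnorm (f y - f y') <= t.
Proof.
move=> [lf [C C0 fC]] t0; have C1 : 0 < C + 1 by rewrite ltr_wpDl.
have [|k [col hcol]] := @disc_totally_bounded _ _ S (t / (C + 1)).
  by rewrite divr_gt0.
exists k, (fun y => col (ofR (C + 1)^-1 * f y)) => y y' y1 y'1 /hcol.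
have small z : rnorm z <= 1 -> rnorm (ofR (C + 1)^-1 * f z) <= 1.
  move=> z1; rewrite rnormM rnorm_ofR ?invr_ge0 ?(ltW C1)//.
  rewrite mulrC ler_pdivrMr// mul1r; apply: le_trans (fC z) _.
  by apply: le_trans (_ : C * 1 <= _); [rewrite ler_wpM2l|rewrite mulr1 lerDl].
move=> /(_ (small _ y1) (small _ y'1)).
rewrite -/(rnorm _) -mulrBr rnormM rnorm_ofR ?invr_ge0 ?(ltW C1)//.
by rewrite mulrC ler_pM2r ?invr_gt0.
Qed.

Lemma totally_bounded_family (Y Z : normedModType K) (T : Y -> Z) (I : finType)
    (f : I -> Y -> K) (t : R) :
  ball_totally_bounded T -> (forall i, functional (f i)) -> 0 < t ->
  exists (k : finType) (col : Y -> k),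
  forall y y', rnorm y <= 1 -> rnorm y' <= 1 -> col y = col y' ->
    rnorm (T y - T y') <= t /\ forall i, rnorm (f i y - f i y') <= t.
Proof.
move=> Ttb ff t0.
suff [k [col hcol]] : exists (k : finType) (col : Y -> k),
  forall y y', rnorm y <= 1 -> rnorm y' <= 1 -> col y = col y' ->
    rnorm (T y - T y') <= t /\
    forall i, i \in enum I -> rnorm (f i y - f i y') <= t.
  exists k, col => y y' y1 y'1 /(hcol _ _ y1 y'1)[h1 h2].
  by split => // i; apply: h2; rewrite mem_enum.
elim: (enum I) => [|i s [k [col IH]]].
  by have [k [col hcol]] := Ttb t t0; exists k, col => y y' y1 y'1 /hcol; split; auto.
have [k' [col' hcol']] := totally_bounded_functional (ff i) t0.
exists (k * k')%type, (fun y => (col y, col' y)) => y y' y1 y'1 [c c'].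
have [h1 h2] := IH _ _ y1 y'1 c; split => // j.
by rewrite inE => /predU1P[->|/h2//]; exact: hcol'.
Qed.

Lemma totally_bounded_net (Y Z : normedModType K) (T : Y -> Z) (I : finType)
    (f : I -> Y -> K) (t : R) :
  ball_totally_bounded T -> (forall i, functional (f i)) -> 0 < t ->
  exists (k : finType) (a : k -> Y), (forall c, rnorm (a c) <= 1) /\
  forall y, rnorm y <= 1 -> exists c, rnorm (T y - T (a c)) <= t /\
    forall i, rnorm (f i y - f i (a c)) <= t.
Proof.
move=> Ttb ff t0; have [k [col hcol]] := totally_bounded_family Ttb ff t0.
(* A colour not taken on the unit ball gets the representative [0]. *)
have /choice[a ha] (c : k) : exists a, rnorm a <= 1 /\
    ((exists2 y, rnorm y <= 1 & col y = c) -> col a = c).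
  have [[y y1 yc]|ny] := pselect (exists2 y, rnorm y <= 1 & col y = c).
    by exists y.
  by exists 0; split=> [|/ny//]; rewrite rnorm0.
exists k, a; split=> [c|y y1]; first by case: (ha c).
exists (col y); have [a1 ac] := ha (col y); apply: hcol => //.
by rewrite ac//; exists y.
Qed.

End TotallyBounded.

(** * Interpolation: compact contractions with prescribed rows *)

Section Lifting.
Context {R : realType} {K : numFieldType} (S : real_or_complex R K).
Context {X : completeNormedModType K} {e : nat -> X -> K}
  {coef : (X -> K) -> nat -> K}.
Context (eB : ell1_basis S e coef).
Context {Y : normedModType K}.
Local Notation re := (re S).
Local Notation ofR := (ofR S).
Local Notation rnorm := (rnorm S).
Local Notation functional := (functional S).
Local Notation ball_totally_bounded := (ball_totally_bounded S).

Definition compact_contraction (T : Y -> X) :=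
  [/\ linear T, ball_totally_bounded T & forall y, rnorm (T y) <= rnorm y].

Lemma functional_comp (T : Y -> X) j : compact_contraction T ->
  functional (fun y => e j (T y)).
Proof.
move=> [lT _ cT]; split=> [a x y|]; first by rewrite lT (basis_linear eB).
by exists 1 => // y; rewrite mul1r; apply: le_trans (basis_le eB _ _) _.
Qed.

Lemma sum_delta (m : nat) (F : 'I_m -> K) (j : nat) :
  \sum_i F i * (val i == j)%:R = if insub j is Some i then F i else 0.
Proof.
case: insubP => [i _ <-|jm].
  rewrite (bigD1 i)//= eqxx mulr1 big1 ?addr0// => k.
  by rewrite -val_eqE => /negPf ->; rewrite mulr0.
rewrite big1// => i _; case: eqP => [ij|_]; last by rewrite mulr0.
by move: jm; rewrite -ij ltn_ord.
Qed.

(** [T] is corrected by the finite-rank map [D y = \sum_i b i y *: w i], where [b i] is the error of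
    row [i] and [w i] imitates in [X] the unit vector [i] of [l_infty]. The bounds on [T + D] and
    [D] are imposed at a finite net; total boundedness spreads them over the ball, and a rescaling
    restores the norm. *)
Lemma approximate_interpolation (T : Y -> X) (m : nat) (v : 'I_m -> Y -> K)
    (d t : R) :
  compact_contraction T -> 0 < d -> 0 < t ->
  (forall j, functional (v j)) -> (forall j y, rnorm (v j y) <= rnorm y) ->
  (forall j y, rnorm (v j y - e j (T y)) <= d * rnorm y) ->
  exists T' : Y -> X, [/\ compact_contraction T',
    forall y, rnorm (T' y - T y) <= (d + t) * rnorm y
    & forall j y, rnorm (v j y - e j (T' y)) <= t * rnorm y].
Proof.
move=> cT d0 t0 fv v1 vd; have [lT tbT T1] := cT.
have mR : 0 <= m%:R :> R by [].
(* [Q] collects the constants of both final estimates; the tolerance [u] is chosen so that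
   [u * Q <= t]. *)
pose Q : R := (d + 4 * m%:R + 2) + m%:R * d.
have Q0 : 0 < Q by rewrite /Q; nra.
have tQ : 0 < t + Q := addr_gt0 t0 Q0.
pose u : R := t / (t + Q).
have u0 : 0 < u by rewrite divr_gt0.
have u1 : u <= 1 by rewrite ler_pdivrMr// mul1r lerDl ltW.
have uQ : u * Q <= t.
  rewrite /u mulrAC ler_pdivrMr// ler_wpM2l ?(ltW t0)//.
  by rewrite lerDr ltW.
pose b j y := v j y - e j (T y).
have fb j : functional (b j).
  have -> : b j = (fun y => (-1) * e j (T y) + v j y).
    by apply/funext => y; rewrite /b mulN1r addrC.
  by apply: functional_lin => //; exact: functional_comp.
have [k [a [a1 net]]] := totally_bounded_net tbT fb u0.
(* Three families of constraints: [T + D] has norm at most [1] at the net, [D] has norm at most [d]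
   there, and each [w i] has norm at most [1]. In [l_infty] the unit vectors [om] fulfil them,
   because [T + D] then has row [v j] for [j < m] and the row of [T] elsewhere. *)
pose p (c : (k + k) + 'I_m) : X := match c with inl (inl c) => T (a c) | _ => 0 end.
pose M (c : (k + k) + 'I_m) (i : 'I_m) : K :=
  match c with inl (inl c) => b i (a c) | inl (inr c) => b i (a c)
             | inr i' => (i == i')%:R end.
pose r (c : (k + k) + 'I_m) : R := match c with inl (inr _) => d | _ => 1 end.
pose om (i : 'I_m) (j : nat) : K := (val i == j)%:R.
have e_lin j : linear (e j : X -> K^o) := basis_linear eB j.
have e0 j : e j 0 = 0 := linear_at0 (e_lin j).
have [|c j|w [wr wom]] := @local_reflexivity R K S X e coef eB _ _ p M r om m u _ u0.
- by case=> [[]|] ?.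
- rewrite sum_delta; case: insubP => [i _ <-|_]; last first.
    rewrite addr0; apply: le_trans (basis_le eB _ _) _.
    case: c => [[c|c]|c] /=; last by rewrite rnorm0.
      exact: le_trans (T1 _) (a1 c).
    by rewrite rnorm0 ltW.
  case: c => [[c|c]|c] /=.
  + by rewrite /b addrC subrK; apply: le_trans (v1 _ _) _.
  + rewrite e0 add0r; apply: le_trans (vd _ _) _.
    by rewrite ler_piMr// ltW.
  + by rewrite e0 add0r; case: eqP; rewrite ?rnorm1 ?rnorm0.
have w1 i : rnorm (w i) <= 2.
  have := wr (inr i); rewrite /= add0r mulr1 (bigD1 i)//= eqxx scale1r big1.
    by rewrite addr0; lra.
  by move=> i' /negPf ->; rewrite scale0r.
pose D y := \sum_i b i y *: w i.
have lD : linear D.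
  move=> s y y'; rewrite /D scaler_sumr -big_split /=; apply: eq_bigr => i _.
  by rewrite (fb i).1 scalerDl scalerA.
have Dsub y y' : D y - D y' = \sum_i (b i y - b i y') *: w i.
  by rewrite /D -sumrB; apply: eq_bigr => i _; rewrite [RHS]scalerBl.
have Ddist (s : R) y y' : (forall i, rnorm (b i y - b i y') <= s) ->
    rnorm (D y - D y') <= 2 * m%:R * s.
  move=> bs; rewrite Dsub; apply: le_trans (rnorm_sum S _ _ _) _.
  apply: le_trans (_ : \sum_(i < m) s * 2 <= _).
    by apply: ler_sum => i _; rewrite rnormZ ler_pM ?rnorm_ge0.
  by rewrite sumr_const card_ord -mulr_natl; lra.
(* The excess of [T + D] over norm [1]: [u] from the net error of [T], [2 * m * u] from that of [D],
   and [u] from local reflexivity. *)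
pose q : R := (2 * m%:R + 2) * u.
have q0 : 0 <= q by rewrite /q; nra.
have q1 : 0 < 1 + q by rewrite ltr_wpDr.
have TD1 y : rnorm y <= 1 -> rnorm (T y + D y) <= 1 + q.
  move=> /net[c [Tc bc]]; have := wr (inl (inl c)); rewrite /= mulr1 -/(D (a c)) => h.
  have -> : T y + D y = (T y - T (a c)) + (D y - D (a c)) + (T (a c) + D (a c)).
    by rewrite [X in _ = X + _]addrACA -opprD subrK.
  have := rnormD S (T y - T (a c) + (D y - D (a c))) (T (a c) + D (a c)).
  have := rnormD S (T y - T (a c)) (D y - D (a c)).
  have := Ddist _ _ _ bc; rewrite /q; lra.
have D1 y : rnorm y <= 1 -> rnorm (D y) <= (1 + u) * d + 2 * m%:R * u.
  move=> /net[c [_ bc]]; have := wr (inl (inr c)); rewrite /= add0r -/(D (a c)) => h.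
  rewrite -[D y](subrK (D (a c))); apply: le_trans (rnormD S _ _) _.
  by have := Ddist _ _ _ bc; lra.
have De y j : rnorm y <= 1 -> rnorm (e (val j) (D y) - b j y) <= m%:R * d * u.
  move=> y1; have eDE : e j (D y) = \sum_i b i y * e j (w i).
    rewrite /D; elim/big_rec2: _ => [|i _ x _ <-]; first exact: e0.
    by rewrite (basis_linear eB).
  have bE : b j y = \sum_i b i y * om i j.
    by rewrite sum_delta valK.
  rewrite eDE bE -sumrB; apply: le_trans (rnorm_sum S _ _ _) _.
  apply: le_trans (_ : \sum_(i < m) d * u <= _).
    apply: ler_sum => i _; rewrite -mulrBr rnormM ler_pM ?rnorm_ge0//.
    by apply: le_trans (vd _ _) _; rewrite ler_piMr// ltW.
  by rewrite sumr_const card_ord -[leLHS]mulr_natl mulrA.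
pose T' y := ofR (1 + q)^-1 *: (T y + D y).
have lT' : linear T'.
  move=> s y y'; rewrite /T' lT lD addrACA -scalerDr [LHS]scalerDr !scalerA.
  by rewrite [_ * s]mulrC.
have T'1 y : rnorm y <= 1 -> rnorm (T' y) <= 1.
  move=> y1; rewrite /T' rnormZ rnorm_ofR ?invr_ge0 ?(ltW q1)//.
  by rewrite mulrC ler_pdivrMr// mul1r TD1.
have T'TD y : rnorm y <= 1 -> rnorm (T' y - (T y + D y)) <= q.
  move=> y1; have -> : T y + D y = ofR (1 + q) *: T' y.
    by rewrite /T' scalerA -rmorphM mulfV ?gt_eqF// rmorph1 scale1r.
  rewrite -{1}[T' y]scale1r -scalerBl rnormZ -{1}(rmorph1 ofR) -rmorphB.
  rewrite rnorm_ofR_abs opprD addNKr normrN ger0_norm//.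
  by rewrite ler_piMr ?T'1.
exists T'; split.
- split=> //; last first.
    by move=> y; rewrite -[leRHS]mul1r; exact: (linear_ball_bound lT' T'1).
  move=> s s0; have s'0 : 0 < s / (1 + 2 * m%:R) by rewrite divr_gt0//; lra.
  have [k' [col hcol]] := totally_bounded_family tbT fb s'0.
  exists k', col => y y' y1 y'1 /(hcol _ _ y1 y'1)[hT hb].
  rewrite /T' -scalerBr rnormZ rnorm_ofR ?invr_ge0 ?(ltW q1)// mulrC.
  rewrite ler_pdivrMr// opprD addrACA; apply: le_trans (rnormD S _ _) _.
  apply: le_trans (_ : s <= _); last by rewrite ler_peMr ?(ltW s0)// lerDl.
  have -> : s = s / (1 + 2 * m%:R) + 2 * m%:R * (s / (1 + 2 * m%:R)).
    by field; apply/eqP; lra.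
  by apply: lerD => //; exact: Ddist.
- have lB : linear (fun y => T' y - T y).
    by move=> s y y'; rewrite lT' lT opprD addrACA scalerBr.
  apply: (linear_ball_bound lB) => y y1.
  have -> : T' y - T y = (T' y - (T y + D y)) + D y by rewrite opprD addrA subrK.
  apply: le_trans (rnormD S _ _) _.
  have := T'TD _ y1; have := D1 _ y1; move: uQ; rewrite /q /Q => ? ? ?.
  have : 0 <= u * (m%:R * d) by rewrite mulr_ge0 ?(ltW u0)// mulr_ge0// ltW.
  by lra.
- move=> j; have lB : linear ((fun y => v j y - e j (T' y)) : Y -> K^o).
    move=> s y y'; rewrite lT' (fv j).1 (basis_linear eB).
    by rewrite opprD addrACA -mulrBr.
  apply: (linear_ball_bound lB) => y y1.
  have e_sub x x' : e j (x - x') = e j x - e j x'.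
    have := basis_linear eB j (-1) x' x; rewrite scaleN1r mulN1r => h.
    by rewrite addrC h addrC.
  have e_add x x' : e j (x + x') = e j x + e j x'.
    by rewrite -[x]scale1r (basis_linear eB) mul1r scale1r.
  have -> : v j y - e j (T' y) =
      - (e j (D y) - b j y) - e j (T' y - (T y + D y)).
    by rewrite e_sub e_add /b; ring.
  apply: le_trans (rnormD S _ _) _; rewrite !rnormN.
  have := De _ j y1; have := T'TD _ y1.
  have := basis_le eB j (T' y - (T y + D y)); move: uQ; rewrite /q /Q => ? ? ? ?.
  have : 0 <= u * d by rewrite mulr_ge0 ?ltW.
  have : 0 <= u * m%:R by rewrite mulr_ge0// ltW.
  by lra.
Qed.

(** Iteration with row error [d / 2 ^+ n]. Step [n] moves the operator by at most
    [d / 2 ^+ n + d / 2 ^+ n.+1], and these moves sum to [3 * d]. *)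
Lemma interpolation (T : Y -> X) (m : nat) (v : 'I_m -> Y -> K) (d : R) :
  compact_contraction T -> 0 < d ->
  (forall j, functional (v j)) -> (forall j y, rnorm (v j y) <= rnorm y) ->
  (forall j y, rnorm (v j y - e j (T y)) <= d * rnorm y) ->
  exists T' : Y -> X, [/\ compact_contraction T',
    forall y, rnorm (T' y - T y) <= 3 * d * rnorm y
    & forall (j : 'I_m) y, e j (T' y) = v j y].
Proof.
move=> cT d0 fv v1 vd.
have p2 n : 0 < 2 ^+ n :> R by rewrite exprn_gt0.
have p2S n (c : R) : c / 2 ^+ n = 2 * (c / 2 ^+ n.+1).
  by rewrite exprS; field; rewrite gt_eqF.
pose good n (T1 : Y -> X) := compact_contraction T1 /\
  forall j y, rnorm (v j y - e j (T1 y)) <= d / 2 ^+ n * rnorm y.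
(* The step is a total function of index and operator; off the good pairs it returns the operator
   unchanged. *)
have /choice[F hF] (q : nat * (Y -> X)) : exists T2, good q.1 q.2 ->
    good q.1.+1 T2 /\
    forall y, rnorm (T2 y - q.2 y) <= 3 * d / 2 * rnorm y / 2 ^+ q.1.
  have [[cq vq]|//] := pselect (good q.1 q.2); last by exists q.2.
  have [||T2 [cT2 T2T T2v]] := approximate_interpolation (d := d / 2 ^+ q.1)
    (t := d / 2 ^+ q.1.+1) cq _ _ fv v1 vq; rewrite ?divr_gt0//.
  exists T2 => _; split=> // y; apply: le_trans (T2T y) _.
  rewrite le_eqVlt; apply/orP; left; apply/eqP.
  by rewrite exprS; field; rewrite gt_eqF.
pose U := fix U n := if n is n'.+1 then F (n', U n') else T.
have goodU n : good n (U n).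
  elim: n => [|n IH]; last by have [] := hF (n, U n) IH.
  by split=> // j y; rewrite expr0 divr1.
have dist y : exists l, forall n, rnorm (l - U n y) <= 2 * (3 * d / 2 * rnorm y) / 2 ^+ n.
  apply: (@geometric_cauchy R K S X (fun n => U n y)).
    by rewrite !mulr_ge0 ?rnorm_ge0// ?invr_ge0 ltW.
  by move=> n; have [_] := hF (n, U n) (goodU n); apply.
have /choice[T' hT'] y : exists l, forall n, rnorm (l - U n y) <= 3 * d * rnorm y / 2 ^+ n.
  have [l hl] := dist y; exists l => n; apply: le_trans (hl n) _.
  by rewrite ler_pM2r ?invr_gt0//; lra.
have lT' : linear T'.
  move=> a y y'; apply/eqP; rewrite -subr_eq0; apply/eqP.
  apply: (rnorm_eq0 (S := S)); apply/eqP; rewrite eq_le rnorm_ge0 andbT.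
  pose c := 3 * d * rnorm (a *: y + y') + rnorm a * (3 * d * rnorm y) + 3 * d * rnorm y'.
  apply: (@le0_geometric R c) => n; have [[lU _ _] _] := goodU n.
  have -> : T' (a *: y + y') - (a *: T' y + T' y') =
      (T' (a *: y + y') - U n (a *: y + y')) - a *: (T' y - U n y) - (T' y' - U n y').
    rewrite lU scalerBr; set A := T' _; set B := a *: T' y; set D := a *: U n y.
    rewrite !opprB -[RHS]addrA [D - B + _]addrACA -opprD addrA subrK//.
  have h1 := hT' (a *: y + y') n; have h2 := hT' y n; have h3 := hT' y' n.
  apply: le_trans (rnormD S _ _) _; rewrite rnormN.
  rewrite /c [leRHS]mulrDl lerD//; apply: le_trans (rnormD S _ _) _.
  rewrite rnormN [leRHS]mulrDl lerD//.
  by rewrite rnormZ -mulrA ler_wpM2l ?rnorm_ge0.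
exists T'; split=> [|y|j y].
- split=> // [s s0|y].
    (* The convergence is uniform on the ball, so a colouring for [U n] at scale [s / 3] serves [T']
       at scale [s]. *)
    have s30 : 0 < s / 3 by rewrite divr_gt0.
    have [n hn] := divr_pow2_le (3 * d) s30; have [[_ tU _] _] := goodU n.
    have [k [col hcol]] := tU _ s30; exists k, col => y y' y1 y'1 /(hcol _ _ y1 y'1) h.
    have ball z : rnorm z <= 1 -> rnorm (T' z - U n z) <= s / 3.
      move=> z1; apply: le_trans (hT' z n) _; apply: le_trans hn.
      by rewrite ler_pM2r ?invr_gt0// ler_piMr// mulr_ge0 ?ltW.
    have := rdist_trans S (U n y) (T' y) (T' y').
    have := rdist_trans S (U n y') (U n y) (T' y').
    have := ball _ y1; have := ball _ y'1; rewrite (rdistC S (U n y')); lra.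
  rewrite -subr_le0; apply: (@le0_geometric R (3 * d * rnorm y)) => n.
  have [[_ _ U1] _] := goodU n; have := U1 y; have := hT' y n.
  by have := rnormD S (T' y - U n y) (U n y); rewrite subrK; lra.
- by have := hT' y 0%N; rewrite expr0 divr1.
- apply/esym/eqP; rewrite -subr_eq0; apply/eqP.
  apply: (rnorm_eq0 (S := S)); apply/eqP; rewrite eq_le rnorm_ge0 andbT.
  apply: (@le0_geometric R (d * rnorm y + 3 * d * rnorm y)) => n.
  have [_ vU] := goodU n; rewrite mulrDl.
  have := basis_linear eB j (-1) (T' y - U n y) (T' y).
  rewrite scaleN1r mulN1r opprB subrK => eU.
  have -> : v j y - e j (T' y) = (v j y - e j (U n y)) - e j (T' y - U n y).
    by rewrite eU; ring.
  apply: le_trans (rnormD S _ _) _; rewrite rnormN lerD//.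
    by apply: le_trans (vU j y) _; rewrite mulrAC.
  exact: le_trans (basis_le eB _ _) (hT' y n).
Qed.

End Lifting.

(** * Interpolation of points *)

Section PointInterpolation.
Context {R : realType} {K : numFieldType} (S : real_or_complex R K).
Context {X : completeNormedModType K} {e : nat -> X -> K}
  {coef : (X -> K) -> nat -> K}.
Context (eB : ell1_basis S e coef).
Local Notation rnorm := (rnorm S).

(** The point [x] is viewed as the operator [a |-> a *: x] on the scalar field, compact since the
    disc is totally bounded; [y] is the image of [1] under the interpolating operator. *)
Lemma point_interpolation (x : X) (m : nat) (z : 'I_m -> K) (d : R) :
  rnorm x <= 1 -> 0 < d -> (forall j, rnorm (z j) <= 1) ->
  (forall j, rnorm (z j - e j x) <= d) ->
  exists y : X, [/\ rnorm y <= 1, rnorm (y - x) <= 3 * d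
    & forall j : 'I_m, e j y = z j].
Proof.
move=> x1 d0 z1 zd.
have lx : linear ((fun a : K^o => a *: x) : K^o -> X).
  by move=> s a b; rewrite scalerDl scalerA.
have cx : compact_contraction S ((fun a : K^o => a *: x) : K^o -> X).
  split=> [//|t t0|a]; last by rewrite rnormZ ler_piMr ?rnorm_ge0.
  have [k [col hcol]] := disc_totally_bounded S t0.
  exists k, col => a b a1 b1 /(hcol _ _ a1 b1) h.
  rewrite -scalerBl rnormZ; apply: le_trans h.
  by rewrite ler_piMr// rnorm_ge0.
have [||j a|T' [[lT' _ T'1] T'x T'e]] :=
  @interpolation R K S X e coef eB K^o _ m (fun j a => a * z j) d cx d0.
- move=> j; split=> [s a b|]; first by rewrite mulrDl mulrA.
  by exists 1 => // a; rewrite mul1r rnormM ler_piMr ?rnorm_ge0.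
- by move=> j a; rewrite rnormM ler_piMr ?rnorm_ge0.
- have -> : e j (a *: x) = a * e j x.
    have lej : linear (e j : X -> K^o) := basis_linear eB j.
    exact: (linear_scale a x lej).
  by rewrite -mulrBr rnormM mulrC ler_wpM2r ?rnorm_ge0.
exists (T' 1); split=> [||j].
- by apply: le_trans (T'1 _) _; rewrite rnorm1.
- by have := T'x 1; rewrite scale1r rnorm1 mulr1.
- by rewrite T'e mul1r.
Qed.

End PointInterpolation.

(** * Almost norming elements of [l_1] and functionals with prescribed support *)

Section Alignment.
Context {R : realType} {K : numFieldType} (S : real_or_complex R K).
Local Notation re := (re S).
Local Notation ofR := (ofR S).
Local Notation rnorm := (rnorm S).
Local Notation functional := (functional S).

Lemma re_ge_dist1 (z : K) : 1 - rnorm (1 - z) <= re z.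
Proof. by have := re_le_rnorm S (1 - z); rewrite reB re_1; lra. Qed.

(** The numbers [al k] lie in the disc, and the defects [1 - re (al k)], weighted by [rnorm (b k)],
    sum to at most [g ^+ 3]. By Markov's inequality the indices with defect above [g ^+ 2 / 2] carry
    mass at most [2 * g]; on the others [rnorm_dist1] gives distance at most [g]. *)
Lemma ell1_alignment (m : nat) (b p : 'I_m -> K) (s : K) (g : R) :
  0 < g -> g < 1 -> rnorm s = 1 -> \sum_k rnorm (b k) <= 1 ->
  (forall k, rnorm (p k) <= 1) -> 1 - g ^+ 3 <= re (s * \sum_k b k * p k) ->
  exists P : pred 'I_m, [/\ forall k, P k -> 0 < rnorm (b k),
    forall k, P k -> rnorm (1 - s * b k * p k * ofR (rnorm (b k))^-1) <= g,
    \sum_(k | ~~ P k) rnorm (b k) <= 2 * g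
    & 1 - 3 * g <= \sum_(k | P k) rnorm (b k)].
Proof.
move=> g0 g1 s1 b1 p1 hs.
pose al k := s * b k * p k * ofR (rnorm (b k))^-1.
have g2 : 0 < g ^+ 2 / 2 by rewrite divr_gt0// exprn_gt0.
have g3 : g ^+ 3 <= g by rewrite -[leRHS]expr1 ler_wiXn2l// ltW.
have wal k : rnorm (b k) * re (al k) = re (s * (b k * p k)).
  have [b0|bn0] := eqVneq (rnorm (b k)) 0.
    by rewrite b0 (rnorm_eq0 b0) !mul0r mulr0 re0.
  rewrite -re_ofRM /al mulrC -!mulrA -rmorphM [_^-1 * _]mulrC mulfV//.
  by rewrite rmorph1 mulr1.
have al1 k : rnorm (al k) <= 1.
  rewrite /al !rnormM s1 mul1r rnorm_ofR ?invr_ge0 ?rnorm_ge0//.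
  have [b0|bn0] := eqVneq (rnorm (b k)) 0; first by rewrite b0 !mul0r.
  by rewrite mulrAC mulfV// mul1r.
have alre k : re (al k) <= 1 := le_trans (re_le_rnorm S _) (al1 k).
have hsum : \sum_k rnorm (b k) * re (al k) = re (s * \sum_k b k * p k).
  by rewrite mulr_sumr re_sum; apply: eq_bigr => k _; rewrite wal.
have defect : \sum_k rnorm (b k) * (1 - re (al k)) <= g ^+ 3.
  under eq_bigr do rewrite mulrBr mulr1.
  by rewrite sumrB hsum; lra.
have total : 1 - g ^+ 3 <= \sum_k rnorm (b k).
  apply: le_trans hs _; rewrite -hsum; apply: ler_sum => k _.
  by rewrite ler_piMr ?rnorm_ge0.
pose P : pred 'I_m := fun k => 1 - re (al k) <= g ^+ 2 / 2.
have bad : \sum_(k | ~~ P k) rnorm (b k) <= 2 * g.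
  rewrite -(ler_pM2r g2); apply: le_trans (_ : g ^+ 3 <= _); last first.
    by rewrite le_eqVlt; apply/orP; left; apply/eqP; field.
  apply: le_trans defect; rewrite mulr_suml [leRHS](bigID P)/= addrC.
  apply: ler_wpDr.
    by apply: sumr_ge0 => k _; rewrite mulr_ge0 ?rnorm_ge0// subr_ge0.
  apply: ler_sum => k; rewrite /P -ltNge => /ltW Pk.
  by rewrite ler_wpM2l ?rnorm_ge0.
have close k : P k -> rnorm (1 - al k) <= g.
  by move=> Pk; apply: rnorm_dist1 => //; exact: ltW.
exists P; split=> //; last first.
  by move: total; rewrite (bigID P)/=; lra.
(* If [b k = 0] then [al k = 0], at distance [1 > g] from [1], so such a [k] is outside [P]. *)
move=> k /close; rewrite lt_neqAle rnorm_ge0 andbT eq_sym.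
have [b0|//] := eqVneq (rnorm (b k)) 0.
by rewrite /al (rnorm_eq0 b0) mulr0 !mul0r subr0 rnorm1; lra.
Qed.

Section SupportFunctional.
Context {X : normedModType K} {e : nat -> X -> K} {coef : (X -> K) -> nat -> K}.
Context (eB : ell1_basis S e coef).
Context (m : nat) (P : pred 'I_m) (w : 'I_m -> R) (a : 'I_m -> K) (k0 : nat) (a0 : K).

(* The missing mass [1 - sum w] is put on one coordinate, so that a point with
   [a k * e k y = c] throughout is mapped to [c]. *)
Definition support_functional (y : X) : K :=
  \sum_(k | P k) ofR (w k) * a k * e k y
  + ofR (1 - \sum_(k | P k) w k) * a0 * e k0 y.

Context (w_ge0 : forall k, P k -> 0 <= w k) (w_le1 : \sum_(k | P k) w k <= 1).
Context (a1 : forall k, P k -> rnorm (a k) = 1) (a01 : rnorm a0 = 1).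

Lemma support_functional_le y : rnorm (support_functional y) <= rnorm y.
Proof.
have lst : rnorm (ofR (1 - \sum_(k | P k) w k) * a0 * e k0 y) <=
    (1 - \sum_(k | P k) w k) * rnorm y.
  rewrite !rnormM rnorm_ofR ?subr_ge0// a01 mulr1 ler_wpM2l ?subr_ge0//.
  exact: basis_le eB _ _.
apply: le_trans (rnormD S _ _) _; apply: le_trans (lerD (rnorm_sum S _ _ _) lst) _.
apply: le_trans (_ : \sum_(k | P k) w k * rnorm y + _ <= _).
  apply: lerD (lexx _); apply: ler_sum => k Pk.
  rewrite !rnormM rnorm_ofR ?w_ge0// a1// mulr1 ler_wpM2l ?w_ge0//.
  exact: basis_le eB _ _.
by rewrite -mulr_suml -mulrDl addrC subrK mul1r.
Qed.

Lemma support_functionalP : functional support_functional.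
Proof.
split=> [s x y|]; last first.
  by exists 1 => // y; rewrite mul1r support_functional_le.
rewrite /support_functional [in RHS]mulrDr [RHS]addrACA; congr (_ + _).
  rewrite mulr_sumr -big_split /=; apply: eq_bigr => k _.
  by rewrite (basis_linear eB); ring.
by rewrite (basis_linear eB); ring.
Qed.

Lemma support_functional_eq y c : (forall k, P k -> a k * e k y = c) ->
  a0 * e k0 y = c -> support_functional y = c.
Proof.
move=> ac a0c; rewrite /support_functional -mulrA a0c.
under eq_bigr => k Pk do rewrite -mulrA ac//.
by rewrite -mulr_suml -mulrDl -rmorph_sum -rmorphD addrC subrK rmorph1 mul1r.
Qed.

Lemma support_functional_dist (h : X -> K) (b : 'I_m -> K) (t1 t2 t3 t4 : R) y :
  rnorm (h y - \sum_k b k * e k y) <= t1 * rnorm y ->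
  \sum_(k | ~~ P k) rnorm (b k) <= t2 ->
  (forall k, P k -> rnorm (b k - ofR (w k) * a k) <= t3 * w k) -> 0 <= t3 ->
  1 - t4 <= \sum_(k | P k) w k ->
  rnorm (h y - support_functional y) <= (t1 + t2 + t3 + t4) * rnorm y.
Proof.
move=> h1 h2 h3 t30 h4.
have -> : h y - support_functional y = (h y - \sum_k b k * e k y)
    + \sum_(k | ~~ P k) b k * e k y
    + \sum_(k | P k) (b k - ofR (w k) * a k) * e k y
    - ofR (1 - \sum_(k | P k) w k) * a0 * e k0 y.
  rewrite /support_functional (bigID P (fun _ => true))/=.
  under [X in _ = _ + X - _]eq_bigr do rewrite mulrBl.
  by rewrite sumrB; ring.
have n0 := rnorm_ge0 S y.
rewrite !mulrDl; apply: le_trans (rnormD S _ _) _; rewrite rnormN lerD//; last first.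
  rewrite !rnormM rnorm_ofR ?subr_ge0// a01 mulr1.
  apply: ler_pM; rewrite ?rnorm_ge0 ?subr_ge0//; first by lra.
  exact: basis_le eB _ _.
apply: le_trans (rnormD S _ _) _; rewrite lerD//; last first.
  apply: le_trans (rnorm_sum S _ _ _) _.
  apply: le_trans (_ : \sum_(k | P k) t3 * w k * rnorm y <= _).
    apply: ler_sum => k Pk; rewrite rnormM ler_pM ?rnorm_ge0 ?h3//.
    exact: basis_le eB _ _.
  by rewrite -mulr_suml -mulr_sumr ler_wpM2r// ler_piMr.
apply: le_trans (rnormD S _ _) _; rewrite lerD//.
apply: le_trans (rnorm_sum S _ _ _) _.
apply: le_trans (_ : \sum_(k | ~~ P k) rnorm (b k) * rnorm y <= _).
  by apply: ler_sum => k Pk; rewrite rnormM ler_wpM2l ?rnorm_ge0// (basis_le eB).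
by rewrite -mulr_suml ler_wpM2r.
Qed.

End SupportFunctional.
End Alignment.

(** * States, numerical radius and norm *)

Section NumericalRadius.
Context {R : realType} {K : numFieldType} (S : real_or_complex R K).
Context {X : completeNormedModType K} {e : nat -> X -> K}
  {coef : (X -> K) -> nat -> K}.
Context (eB : ell1_basis S e coef).
Local Notation re := (re S).
Local Notation ofR := (ofR S).
Local Notation rnorm := (rnorm S).
Local Notation functional := (functional S).
Local Notation compact_contraction := (compact_contraction S).

Lemma statesP (x : X) (f : X -> K^o) : states (x, f) <->
  [/\ rnorm x <= 1, functional f, forall y, rnorm (f y) <= rnorm y & f x = 1].
Proof.
split=> [[/= x1 /(dualP S) ff f1 fx]|[x1 ff fle fx]].
  split=> //; first by rewrite rnorm_le rmorph1 x1.
  have [c [cE c0 fc _]] := functional_opnorm ff.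
  have c1 : c = 1 by apply: (fmorph_inj ofR); rewrite -cE f1 rmorph1.
  by move=> y; have := fc y; rewrite c1 mul1r.
have xE : rnorm x = 1.
  by apply/eqP; rewrite eq_le x1 -(rnorm1 S) -fx fle.
split=> /=; [|exact/(dualP S)| |exact: fx].
  by rewrite -(ofR_rnorm S) xE rmorph1.
have [c [-> c0 fc cmin]] := functional_opnorm ff.
have c1 : c <= 1 by apply: cmin => // y; rewrite mul1r.
suff -> : c = 1 by rewrite rmorph1.
apply/eqP; rewrite eq_le c1 -[c]mulr1 -[X in c * X]xE.
by apply: le_trans (fc x); rewrite fx rnorm1.
Qed.

Lemma numerical_radius_bound (T : X -> X) (C : R) : @states K X !=set0 ->
  (forall p, states p -> rnorm (p.2 (T p.1) : K) <= C) ->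
  exists s, [/\ numerical_radius T = ofR s,
    forall y f, states (y, f) -> rnorm (f (T y) : K) <= s
    & forall c, (forall p, states p -> rnorm (p.2 (T p.1) : K) <= c) -> s <= c].
Proof.
move=> st0 TC.
have [s [sE sle smin]] := @supremum_norm R K S _ (@states K X) K
  (fun p => p.2 (T p.1)) C st0 TC.
by exists s; split=> // y f /sle.
Qed.

(** Each row [u = e n o T] is tested at a ball point [y] whose first coordinates are unimodular with
    the phases that turn the terms of [u y] positive. Coordinate [n] is among them, so a multiple of
    [e n] makes [y] a state, and the [l_1] norm of [u] is at most the numerical radius up to [t]. *)
Lemma numerical_radius_contraction (T : X -> X) :
  compact_operators X T -> @states K X !=set0 -> numerical_radius T = 1 ->
  compact_contraction T.
Proof.
move=> /(compact_operatorsP S)[lT tT] st0 nuT; split=> // x0.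
(* A net with an empty family of functionals, used only to get some bound [C] for [T]. *)
have [k [a [a1 net]]] := totally_bounded_net tT
  (f := fun (i : 'I_0) (x : X) => 0) (fun _ => functional0 S X) (@ltr01 R).
pose C := 1 + \sum_c rnorm (T (a c)).
have TC : forall x, rnorm (T x) <= C * rnorm x.
  apply: (linear_ball_bound lT) => x /net[c [Tc _]].
  rewrite -[T x](subrK (T (a c))); apply: le_trans (rnormD S _ _) _.
  rewrite lerD// (bigD1 c)//= lerDl; apply: sumr_ge0 => i _; exact: rnorm_ge0.
have C0 : 0 <= C.
  by rewrite addr_ge0// sumr_ge0// => i _; exact: rnorm_ge0.
have [|s [sE sle _]] := @numerical_radius_bound T C st0.
  move=> [x f] /statesP[x1 _ f1 _] /=; apply: le_trans (f1 _) _.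
  by apply: le_trans (TC x) _; rewrite ler_piMr.
have s1 : s = 1 by apply: (fmorph_inj ofR); rewrite -sE nuT rmorph1.
rewrite -[leRHS]mul1r; apply: (linear_ball_bound lT) => x x1.
apply: (rnorm_le_sup eB) => n; apply: ler_addeps => t t0.
have fu : functional (fun y => e n (T y)).
  split=> [b y z|]; first by rewrite lT (basis_linear eB).
  by exists C => // y; apply: le_trans (basis_le eB _ _) (TC y).
set u := (fun y => e n (T y)) in fu.
have t20 : 0 < t / 2 by rewrite divr_gt0.
have [N hN] := coef_expand eB fu t20; pose m := maxn N n.+1.
have {}hN := hN m (leq_maxl _ _).
have /choice[z hz] (j : nat) : exists z : K,
    rnorm z = 1 /\ z * coef u j = ofR (rnorm (coef u j)).
  by have [z] := phase S (coef u j); exists z.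
have lej j : linear (e j : X -> K^o) := basis_linear eB j.
(* Interpolation starts from [0], where [d = 1] allows arbitrary values in the disc. *)
have [||j|j|y [y1 _ yz]] := @point_interpolation R K S X e coef eB 0 m (fun j => z j) 1.
- by rewrite rnorm0.
- exact: ltr01.
- by rewrite (hz j).1.
- by rewrite (linear_at0 (lej j)) subr0 (hz j).1.
have nm : (n < m)%N by exact: leq_maxr.
pose f (y' : X) : K := (z n)^-1 * e n y'.
have z0 : z n != 0 := rnorm1_neq0 (hz n).1.
have yf : states (y, f : X -> K^o).
  apply/statesP; split=> // [|y'|].
  - have -> : f = (fun y' => (z n)^-1 * e n y' + 0) by apply/funext => y'; rewrite addr0.
    by apply: functional_lin; [exact: (functional_basis eB)|exact: functional0].
  - by rewrite rnormM rnormV (hz n).1 invr1 mul1r (basis_le eB).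
  - by rewrite /f (yz (Ordinal nm)) mulVf.
have uy : rnorm (u y) <= 1.
  have := sle _ _ yf; rewrite s1 /= /f rnormM rnormV (hz n).1 invr1 mul1r.
  by apply: le_trans.
have sumE : \sum_(j < m) coef u j * e j y = ofR (\sum_(j < m) rnorm (coef u j)).
  by rewrite rmorph_sum; apply: eq_bigr => j _; rewrite yz mulrC (hz j).2.
have hx := hN x; have hy := hN y.
have sx : rnorm (\sum_(j < m) coef u j * e j x) <= \sum_(j < m) rnorm (coef u j).
  apply: le_trans (rnorm_sum S _ _ _) _; apply: ler_sum => j _.
  by rewrite rnormM ler_piMr ?rnorm_ge0// (le_trans (basis_le eB _ _)).
have sy : \sum_(j < m) rnorm (coef u j) <= rnorm (u y) + t / 2.
  rewrite -(re_ofR S (\sum_(j < m) rnorm (coef u j))) -sumE.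
  apply: le_trans (re_le_rnorm S _) _.
  set s' := \sum_(j < m) _ in hy *.
  have -> : s' = u y - (u y - s') by rewrite opprB addrC subrK.
  apply: le_trans (rnormD S _ _) _; rewrite rnormN lerD2l.
  by apply: le_trans hy _; rewrite ler_piMr ?(ltW t20).
rewrite -/(u x) -[u x](subrK (\sum_(j < m) coef u j * e j x)).
apply: le_trans (rnormD S _ _) _.
have : t / 2 * rnorm x <= t / 2 by rewrite ler_piMr ?(ltW t20).
by lra.
Qed.

(** The equality case of the triangle inequality: the terms [coef f k * e k x] sum to [1] while
    their moduli sum to at most [1], so each term equals its largest possible modulus. *)
Lemma norming_coef (f : X -> K) x n : functional f ->
  (forall y, rnorm (f y) <= rnorm y) -> rnorm x <= 1 -> f x = 1 ->
  coef f n * e n x = ofR (rnorm (coef f n)).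
Proof.
move=> ff f1 x1 fx.
have e1 j : rnorm (e j x) <= 1 := le_trans (basis_le eB j x) x1.
have [F0|Fn0] := eqVneq (rnorm (coef f n)) 0.
  by rewrite (rnorm_eq0 F0) mul0r rnorm0 rmorph0.
have Fp : 0 < rnorm (coef f n) by rewrite lt_neqAle eq_sym Fn0 rnorm_ge0.
have key : rnorm (coef f n) <= re (coef f n * e n x).
  apply: ler_addeps => t t0.
  have [N hN] := coef_expand_at eB x ff t0; pose m := maxn N n.+1.
  have nm : (n < m)%N by exact: leq_maxr.
  have fle y : rnorm (f y) <= 1 * rnorm y by rewrite mul1r.
  have h1 := coef_sum_le eB m ff ler01 fle.
  have h2 := le_trans (re_le_rnorm S _) (hN m (leq_maxl _ _)).
  rewrite (bigD1 (Ordinal nm))//= in h1.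
  rewrite reB fx re_1 re_sum (bigD1 (Ordinal nm))//= in h2.
  have : \sum_(j < m | j != Ordinal nm) re (coef f j * e j x) <=
      \sum_(j < m | j != Ordinal nm) rnorm (coef f j).
    apply: ler_sum => j _; apply: le_trans (re_le_rnorm S _) _.
    by rewrite rnormM ler_piMr ?rnorm_ge0.
  by lra.
pose c := ofR (rnorm (coef f n))^-1 * (coef f n * e n x).
have c1 : rnorm c <= 1.
  rewrite /c !rnormM rnorm_ofR ?invr_ge0 ?rnorm_ge0// mulrA mulVf// mul1r.
  exact: e1.
(* A point of the disc with real part at least [1] is [1]: [rnorm_dist1] with radius zero. *)
have : rnorm (1 - c) <= 0.
  apply: rnorm_dist1 => //; rewrite expr0n mul0r subr_le0 /c re_ofRM.
  by rewrite ler_pdivlMl// mulr1.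
move=> c0; have /rnorm_eq0/eqP : rnorm (1 - c) = 0.
  by apply/eqP; rewrite eq_le c0 rnorm_ge0.
rewrite subr_eq0 => /eqP cE.
by rewrite -[RHS]mulr1 cE /c mulrA -rmorphM mulfV// rmorph1 mul1r.
Qed.

End NumericalRadius.

(** * The perturbation of operator, point and functional *)

Section Main.
Context {R : realType} {K : numFieldType} (S : real_or_complex R K).
Context {X : completeNormedModType K} {e : nat -> X -> K}
  {coef : (X -> K) -> nat -> K}.
Context (eB : ell1_basis S e coef).
Local Notation re := (re S).
Local Notation ofR := (ofR S).
Local Notation rnorm := (rnorm S).
Local Notation functional := (functional S).
Local Notation compact_contraction := (compact_contraction S).

Lemma coef_expand_family (I : finType) (f : I -> X -> K) (t : R) (N : nat) :
  (forall i, functional (f i)) -> 0 < t ->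
  exists2 m, (N <= m)%N & forall i x,
    rnorm (f i x - \sum_(k < m) coef (f i) k * e k x) <= t * rnorm x.
Proof.
move=> ff t0; have /choice[M hM] i := coef_expand eB (ff i) t0.
exists (maxn N (\max_i M i)) => [|i]; first exact: leq_maxl.
by apply: hM; rewrite leq_max leq_bigmax orbT.
Qed.

(* [y] has the coordinates of [x], rounded to modulus one where they are almost
   unimodular. *)
Lemma functional_round (u : X -> K) (x y : X) (c : K) (m n : nat) (g : R) :
  0 < g -> g < 1 -> functional u -> (forall z, rnorm (u z) <= rnorm z) ->
  rnorm c = 1 -> rnorm x <= 1 -> rnorm (1 - c^-1 * u x) <= g ^+ 3 / 2 ->
  (forall z, rnorm (u z - \sum_(k < m) coef u k * e k z) <= g ^+ 3 / 2 * rnorm z) ->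
  rnorm (e n y) = 1 ->
  (forall k, (k < m)%N -> 1 - g <= rnorm (e k x) ->
     e k y = ofR (rnorm (e k x))^-1 * e k x) ->
  exists v : X -> K, [/\ functional v, forall z, rnorm (v z) <= rnorm z, v y = c
    & forall z, rnorm (v z - u z) <= 8 * g * rnorm z].
Proof.
move=> g0 g1 fu u1 c1 x1 ux hm en1 ey.
have c0 : c != 0 := rnorm1_neq0 c1.
have g3 : g ^+ 3 <= g by rewrite -[leRHS]expr1 ler_wiXn2l// ltW.
have cV1 : rnorm c^-1 = 1 by rewrite rnormV c1 invr1.
have ex1 k : rnorm (e k x) <= 1 := le_trans (basis_le eB k x) x1.
have csum : \sum_(k < m) rnorm (coef u k) <= 1.
  by apply: (coef_sum_le eB m fu ler01) => z; rewrite mul1r.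
have [|P [Ppos Pnear Pbad Pgood]] := @ell1_alignment R K S m (fun k => coef u k)
    (fun k => e k x) c^-1 g g0 g1 cV1 csum (fun k => ex1 k).
  have -> : \sum_(k < m) coef u k * e k x = u x - (u x - \sum_(k < m) coef u k * e k x).
    by rewrite opprB addrC subrK.
  rewrite mulrBr reB; have := re_ge_dist1 S (c^-1 * u x).
  have := re_le_rnorm S (c^-1 * (u x - \sum_(k < m) coef u k * e k x)).
  rewrite rnormM cV1 mul1r; have := hm x.
  have : g ^+ 3 / 2 * rnorm x <= g ^+ 3 / 2.
    by rewrite ler_piMr// divr_ge0// exprn_ge0// ltW.
  by lra.
(* An aligned coordinate of [x] has modulus at least [1 - g], so it is among those rounded in
   [y]. *)
have P_big k : P k -> 1 - g <= rnorm (e k x).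
  move=> Pk; have := Pnear _ Pk; have := Ppos _ Pk => b0.
  set al := _ * ofR _ => al1.
  have -> : rnorm (e k x) = rnorm al.
    rewrite /al !rnormM cV1 mul1r rnorm_ofR ?invr_ge0 ?rnorm_ge0//.
    by rewrite mulrAC mulfV ?mul1r// gt_eqF.
  have := rnormD S (1 - al) al; rewrite subrK rnorm1; lra.
have P_ey k : P k -> e k y = ofR (rnorm (e k x))^-1 * e k x.
  by move=> Pk; apply: ey => //; exact: P_big.
have P_pos k : P k -> 0 < rnorm (e k x).
  by move=> /P_big; lra.
have P_ey1 k : P k -> rnorm (e k y) = 1.
  move=> Pk; rewrite P_ey// rnormM rnorm_ofR ?invr_ge0 ?rnorm_ge0//.
  by rewrite mulVf// gt_eqF ?P_pos.
have P_ey0 k : P k -> e k y != 0 by move=> /P_ey1; exact: rnorm1_neq0.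
have en0 : e n y != 0 := rnorm1_neq0 en1.
pose w (k : 'I_m) := rnorm (coef u k).
(* The phase for which [a k * e k y = c]; the moduli [w k] of the coefficients are kept. *)
pose a (k : 'I_m) := c * (e k y)^-1.
have w_ge0 k : P k -> 0 <= w k by rewrite rnorm_ge0.
have w_le1 : \sum_(k | P k) w k <= 1.
  apply: le_trans csum; rewrite [leRHS](bigID P)/= lerDl.
  by apply: sumr_ge0 => k _; exact: rnorm_ge0.
have a1 k : P k -> rnorm (a k) = 1.
  by move=> Pk; rewrite rnormM c1 rnormV P_ey1// invr1 mulr1.
have a01 : rnorm (c * (e n y)^-1) = 1 by rewrite rnormM c1 rnormV en1 invr1 mulr1.
have near k : P k -> rnorm (coef u k - ofR (w k) * a k) <= 2 * g * w k.
  move=> Pk; have w0 := Ppos _ Pk; have x0 := P_pos _ Pk.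
  pose q := rnorm (e k x).
  pose al := c^-1 * coef u k * e k x * ofR (w k)^-1.
  (* [be] is [al] with [e k x] replaced by its rounding [e k y]; the rounding costs a second [g]. *)
  pose be := ofR q^-1 * al.
  have al1 : rnorm al = q.
    rewrite /al !rnormM cV1 mul1r rnorm_ofR ?invr_ge0 ?rnorm_ge0//.
    by rewrite mulrAC mulfV ?mul1r// gt_eqF.
  have bal : rnorm (al - be) <= g.
    have -> : al - be = (ofR q - 1) * be.
      have {1}-> : al = ofR q * be.
        by rewrite /be [RHS]mulrA -rmorphM mulfV ?rmorph1 ?mul1r// gt_eqF.
      by rewrite mulrBl mul1r.
    rewrite rnormM /be rnormM al1 rnorm_ofR ?invr_ge0 ?rnorm_ge0//.
    rewrite mulVf ?gt_eqF// mulr1 -(rmorph1 ofR) -rmorphB rnorm_ofR_abs.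
    rewrite ler0_norm ?subr_le0 ?ex1// opprB.
    by have := P_big _ Pk; rewrite -/q; lra.
  have be1 : rnorm (1 - be) <= 2 * g.
    by have := rdist_trans S al 1 be; have := Pnear _ Pk; rewrite -/al; lra.
  have -> : coef u k - ofR (w k) * a k = - (1 - be) * (ofR (w k) * a k).
    rewrite mulNr mulrBl mul1r opprB; congr (_ - _).
    rewrite /be /al /a P_ey// -/q.
    have wE : ofR (w k)^-1 * ofR (w k) = 1 by rewrite -rmorphM mulVf ?rmorph1// gt_eqF.
    have qn0 : ofR q != 0 by rewrite fmorph_eq0 gt_eqF.
    have wn0 : ofR (w k) != 0 by rewrite fmorph_eq0 gt_eqF.
    have xn0 : e k x != 0.
      by apply/eqP => h0; move: x0; rewrite h0 rnorm0 ltxx.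
    by rewrite !fmorphV; field; rewrite c0 qn0 wn0 xn0.
  rewrite rnormM rnormN rnormM a1// mulr1 rnorm_ofR ?w_ge0//.
  by rewrite ler_wpM2r ?w_ge0.
(* The missing mass goes to coordinate [n], where [y] is unimodular by hypothesis. *)
exists (@support_functional R K S X e m P w a n (c * (e n y)^-1)); split.
- exact: (support_functionalP eB n w_ge0 w_le1 a1 a01).
- exact: (support_functional_le eB n w_ge0 w_le1 a1 a01).
- apply: support_functional_eq => [k Pk|]; first by rewrite /a mulfVK ?P_ey0.
  by rewrite mulfVK.
- move=> z; rewrite rdistC.
  have g20 : 0 <= 2 * g by rewrite mulr_ge0// ltW.
  have h := support_functional_dist eB n w_le1 a01 (hm z) Pbad near g20 Pgood.
  apply: le_trans h _.
  by rewrite ler_wpM2r ?rnorm_ge0//; lra.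
Qed.

(** The constants are nested. Aligning [f] along [T x] with parameter [g1] needs defect at most
    [g1 ^+ 3]: one [eta] from the hypothesis, one from truncating [f]. The resulting distance [g1]
    is below the [g ^+ 3 / 2] needed to round the rows. Rounding moves rows by [8 * g], and
    interpolation triples this. *)
Lemma bpb_contraction (g : R) (T : X -> X) (x : X) (f : X -> K) :
  let g1 := g ^+ 3 / 4 in let eta := g1 ^+ 3 / 2 in
  0 < g -> g < 1 -> compact_contraction T -> functional f ->
  (forall z, rnorm (f z) <= rnorm z) -> rnorm x <= 1 -> f x = 1 ->
  1 - eta < rnorm (f (T x)) ->
  exists (T' : X -> X) (y : X) (h : X -> K),
    [/\ compact_contraction T', functional h,
      [/\ forall z, rnorm (h z) <= rnorm z, rnorm y <= 1, h y = 1
        & rnorm (h (T' y)) = 1]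
      & [/\ forall z, rnorm (T' z - T z) <= 24 * g * rnorm z,
        rnorm (y - x) <= 3 * g
        & forall z, rnorm (f z - h z) <= 6 * g * rnorm z]].
Proof.
move=> g1 eta g0 glt1 cT ff f1 x1 fx fTx; have [lT tT T1] := cT.
have g3 : g ^+ 3 <= g by rewrite -[leRHS]expr1 ler_wiXn2l// ltW.
have g30 : 0 < g ^+ 3 by rewrite exprn_gt0.
have g10 : 0 < g1 by rewrite divr_gt0.
have g1g : g1 <= g by rewrite /g1; lra.
have g1lt1 : g1 < 1 by exact: le_lt_trans glt1.
have g13 : g1 ^+ 3 <= g1 by rewrite -[leRHS]expr1 ler_wiXn2l// ltW.
have g130 : 0 < g1 ^+ 3 by rewrite exprn_gt0.
have eta0 : 0 < eta by rewrite divr_gt0.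
have e1 j : rnorm (e j x) <= 1 := le_trans (basis_le eB j x) x1.
have fN n := norming_coef eB n ff f1 x1 fx.
have ex_unit n : 0 < rnorm (coef f n) -> rnorm (e n x) = 1.
  move=> Fp; have := congr1 (fun c : K => rnorm c) (fN n); rewrite rnormM rnorm_ofR ?rnorm_ge0//.
  by rewrite -[RHS]mulr1; apply: mulfI; rewrite gt_eqF.
have fsum m : \sum_(k < m) rnorm (coef f k) <= 1.
  by apply: (coef_sum_le eB m ff ler01) => z; rewrite mul1r.
have [N hN] := coef_expand eB ff eta0; have {}hN := hN N (leqnn _).
pose u n y := e n (T y).
have fu n : functional (u n) by exact: (functional_comp eB n cT).
have u1 n z : rnorm (u n z) <= rnorm z := le_trans (basis_le eB n (T z)) (T1 z).
pose s0 := \sum_(n < N) coef f n * u n x.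
(* [th^-1] is the common phase: aligned rows are to take the value [th^-1 * e n x] at [y]. *)
have [th th1 ths] := phase S s0.
have th0 : th != 0 := rnorm1_neq0 th1.
have thV1 : rnorm th^-1 = 1 by rewrite rnormV th1 invr1.
have [||P [Ppos Pnear Pbad Pgood]] := @ell1_alignment R K S N (fun n => coef f n)
    (fun n => u n x) th g1 g10 g1lt1 th1 (fsum N).
- by move=> n; apply: le_trans (u1 _ _) x1.
- rewrite ths re_ofR; have := hN (T x); rewrite -/s0 => hTx.
  have : rnorm (f (T x)) <= rnorm (f (T x) - s0) + rnorm s0.
    by have := rnormD S (f (T x) - s0) s0; rewrite subrK.
  have : eta * rnorm (T x) <= eta.
    by rewrite ler_piMr ?(ltW eta0)// (le_trans (T1 x)).
  by rewrite /eta in fTx hTx *; lra.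
have P_unit n : P n -> rnorm (e n x) = 1 by move=> /Ppos; exact: ex_unit.
have P_ex0 n : P n -> e n x != 0 by move=> /P_unit; exact: rnorm1_neq0.
have coefE n : P n -> coef f n = ofR (rnorm (coef f n)) * (e n x)^-1.
  by move=> Pn; rewrite -fN mulfK ?P_ex0.
have P_near n : P n -> rnorm (1 - (th^-1 * e n x)^-1 * u n x) <= g1.
  move=> Pn; have -> : (th^-1 * e n x)^-1 * u n x =
      th * coef f n * u n x * ofR (rnorm (coef f n))^-1; last exact: Pnear.
  rewrite {1}coefE//; have b0 := Ppos _ Pn.
  have bn0 : ofR (rnorm (coef f n)) != 0 by rewrite fmorph_eq0 gt_eqF.
  by rewrite fmorphV; field; rewrite th0 P_ex0// bn0.
(* Some coordinate is aligned; it will receive the missing mass of the new functional. *)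
have [n0 Pn0] : exists n, P n.
  apply: contrapT => noP; move: Pgood; rewrite big1 => [|n Pn]; last first.
    by case: noP; exists n.
  have : g1 <= 1 / 4 by rewrite /g1; lra.
  by lra.
have g320 : 0 < g ^+ 3 / 2 by rewrite divr_gt0.
have [m Nm hm] := coef_expand_family N (fun n : 'I_N => fu n) g320.
pose z (k : 'I_m) : K :=
  if 1 - g <= rnorm (e k x) then ofR (rnorm (e k x))^-1 * e k x else e k x.
have [k|k|y [y1 yx ey]] := @point_interpolation R K S X e coef eB x m z g x1 g0.
- rewrite /z; case: ifP => // xg.
  rewrite rnormM rnorm_ofR ?invr_ge0 ?rnorm_ge0// mulVf// gt_eqF//.
  by apply: lt_le_trans xg; lra.
- rewrite /z; case: ifP => [xg|_]; last by rewrite subrr rnorm0 ltW.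
  have q0 : 0 < rnorm (e k x) by apply: lt_le_trans xg; lra.
  have -> : ofR (rnorm (e k x))^-1 * e k x - e k x
      = ofR ((rnorm (e k x))^-1 - 1) * e k x.
    by rewrite rmorphB rmorph1 mulrBl mul1r.
  rewrite rnormM rnorm_ofR ?subr_ge0 ?invf_ge1 ?e1// mulrBl mul1r.
  by rewrite mulVf ?gt_eqF//; lra.
have ey' k : (k < m)%N -> 1 - g <= rnorm (e k x) ->
    e k y = ofR (rnorm (e k x))^-1 * e k x.
  by move=> km xg; rewrite (ey (Ordinal km)) /z /= xg.
(* Rounding fixes coordinates that are already unimodular, so [x] and [y] agree on [P]. *)
have P_ey n : P n -> e n y = e n x.
  move=> Pn; rewrite ey' ?P_unit// ?invr1 ?rmorph1 ?mul1r//; last by lra.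
  exact: leq_trans (ltn_ord n) Nm.
have /choice[v hv] (n : 'I_N) : exists v : X -> K, P n ->
    [/\ functional v, forall z, rnorm (v z) <= rnorm z, v y = th^-1 * e n x
      & forall z, rnorm (v z - u n z) <= 8 * g * rnorm z].
  have [Pn|//] := boolP (P n); last by exists (u n).
  have c1 : rnorm (th^-1 * e n x) = 1 by rewrite rnormM thV1 P_unit// mulr1.
  have ux : rnorm (1 - (th^-1 * e n x)^-1 * u n x) <= g ^+ 3 / 2.
    by apply: le_trans (P_near _ Pn) _; rewrite /g1; lra.
  have eny1 : rnorm (e n y) = 1 by rewrite P_ey// P_unit.
  have [v hv] := functional_round g0 glt1 (fu n) (u1 n) c1 x1 ux (hm n) eny1 ey'.
  by exists v.
(* Aligned rows are replaced by their roundings; all other prescribed rows stay those of [T]. *)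
pose V (j : 'I_m) : X -> K :=
  if insub (val j) is Some n then if P n then v n else u j else u j.
have [||||T' [cT' T'T eT']] := @interpolation R K S X e coef eB X T m V (8 * g) cT.
- by rewrite mulr_gt0.
- move=> j; rewrite /V; case: insubP => [n _ _|//].
  by case: ifP => // /hv[].
- move=> j w; rewrite /V; case: insubP => [n _ _|_]; last exact: u1.
  by case: ifP => [/hv[]//|_]; exact: u1.
- move=> j w; have n8 : 0 <= 8 * g * rnorm w by rewrite !mulr_ge0 ?rnorm_ge0 ?ltW.
  rewrite /V; case: insubP => [n _ nj|_]; last by rewrite subrr rnorm0.
  by case: ifP => [/hv[_ _ _]|_]; [rewrite -nj; apply|rewrite subrr rnorm0].
have eT'P n : P n -> e n (T' y) = th^-1 * e n x.
  move=> Pn; have nm : (n < m)%N := leq_trans (ltn_ord n) Nm.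
  by rewrite (eT' (Ordinal nm)) /V /= valK Pn; have [] := hv _ Pn.
pose w (n : 'I_N) := rnorm (coef f n).
pose a (n : 'I_N) := (e n x)^-1.
have w_ge0 n : P n -> 0 <= w n by rewrite rnorm_ge0.
have w_le1 : \sum_(n | P n) w n <= 1.
  apply: le_trans (fsum N); rewrite [leRHS](bigID P)/= lerDl.
  by apply: sumr_ge0 => n _; exact: rnorm_ge0.
have a1 n : P n -> rnorm (a n) = 1 by move=> Pn; rewrite rnormV P_unit// invr1.
have near n : P n -> rnorm (coef f n - ofR (w n) * a n) <= 0 * w n.
  by move=> Pn; rewrite mul0r {1}coefE// subrr rnorm0.
(* By [coefE] this is the restriction of [f] to [P], with the missing mass put on [n0]. *)
pose h := @support_functional R K S X e N P w a n0 (a n0).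
exists T', y, h; split=> //.
- exact: (support_functionalP eB n0 w_ge0 w_le1 a1 (a1 _ Pn0)).
- split=> //.
  + exact: (support_functional_le eB n0 w_ge0 w_le1 a1 (a1 _ Pn0)).
  + apply: support_functional_eq => [n Pn|]; first by rewrite /a P_ey// mulVf ?P_ex0.
    by rewrite /a P_ey// mulVf ?P_ex0.
  + suff -> : h (T' y) = th^-1 by [].
    apply: support_functional_eq => [n Pn|].
      by rewrite /a eT'P// mulrCA mulVf ?P_ex0// mulr1.
    by rewrite /a eT'P// mulrCA mulVf ?P_ex0// mulr1.
- split=> // [w'|w'].
    by apply: le_trans (T'T w') _; rewrite ler_wpM2r ?rnorm_ge0//; lra.
  have hd := support_functional_dist eB n0 w_le1 (a1 _ Pn0) (hN w') Pbad near (lexx _) Pgood.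
  apply: le_trans hd _; rewrite ler_wpM2r ?rnorm_ge0//.
  by rewrite /eta; lra.
Qed.

Theorem ell1_basis_BPBp_nu_compact : BPBp_nu_compact X.
Proof.
move=> eps /andP[eps0 eps1].
have [e0 epsE] := ofR_gt0_re S eps0.
(* The largest distance in [bpb_contraction] is [24 * g], below [re eps] for this choice. *)
pose g := re eps / 100.
have e_lt1 : re eps < 1 by rewrite -(ltr_ofR S) epsE rmorph1.
have g0 : 0 < g by rewrite divr_gt0.
have g_lt1 : g < 1 by rewrite /g; lra.
pose eta := (g ^+ 3 / 4) ^+ 3 / 2.
have eta0 : 0 < eta by rewrite divr_gt0// exprn_gt0// divr_gt0// exprn_gt0.
have eta1 : eta < 1.
  have h1 : g ^+ 3 <= 1 by rewrite exprn_ile1// ltW.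
  have h2 : (g ^+ 3 / 4) ^+ 3 <= 1.
    by rewrite exprn_ile1//; [rewrite divr_ge0// exprn_ge0// ltW|lra].
  by rewrite /eta; lra.
exists (ofR eta).
  by rewrite -(rmorph0 ofR) -(rmorph1 ofR) !ltr_ofR eta0.
move=> T x f cT stxf nuT fTx.
have st0 : @states K X !=set0 by exists (x, f).
have cT' := numerical_radius_contraction eB cT st0 nuT.
have /(statesP S)[x1 ff f1 fx] := stxf.
have fTx' : 1 - eta < rnorm (f (T x) : K).
  by rewrite -(ltr_ofR S) rmorphB rmorph1 ofR_rnorm.
have [T' [y [h [cT'' fh [h1 y1 hy hTy] [TT' xy fh_dist]]]]] :=
  bpb_contraction g0 g_lt1 cT' ff f1 x1 fx fTx'.
have [lT' tT' T'1] := cT''.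
have sth : states (y, h : X -> K^o) by apply/(statesP S).
exists T', y, h; split=> //.
- by apply/(compact_operatorsP S).
- split; last by rewrite -(ofR_rnorm S) hTy rmorph1.
  (* A contraction has numerical radius at most [1], and the state formed by [y] and [h] attains
     it. *)
  have hle p : states p -> rnorm (p.2 (T' p.1) : K) <= 1.
    case: p => z k /(statesP S)[z1 _ k1 _] /=.
    by apply: le_trans (k1 _) _; apply: le_trans (T'1 z) z1.
  have [s [-> sle smin]] := numerical_radius_bound st0 hle.
  suff -> : s = 1 by rewrite rmorph1.
  by apply/eqP; rewrite eq_le smin//= -hTy sle.
- have [lT _ _] := cT'; split.
  + have lD : linear (T \- T').
      by move=> a z z'; rewrite /= lT lT' opprD addrACA scalerBr.
    have [|c [-> _ _ cmin]] := opnormP (S := S) (C := 24 * g) lD.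
      by move=> z /=; rewrite rdistC.
    rewrite -epsE ltr_ofR; apply: le_lt_trans (cmin (24 * g) _ _) _.
    * by rewrite mulr_ge0// ltW.
    * by move=> z /=; rewrite rdistC.
    * by rewrite /g; lra.
  + rewrite -epsE -rnorm_lt rdistC; apply: le_lt_trans xy _.
    by rewrite /g; lra.
  + have lD : linear (f \- h : X -> K^o).
      by move=> a z z'; rewrite /= ff.1 fh.1 opprD addrACA -mulrBr.
    have [|c [-> _ _ cmin]] := opnormP (S := S) (C := 6 * g) lD.
      exact: fh_dist.
    rewrite -epsE ltr_ofR; apply: le_lt_trans (cmin (6 * g) _ fh_dist) _.
      by rewrite mulr_ge0// ltW.
    by rewrite /g; lra.
Qed.

End Main.

Theorem corollary2p6 (R : realType) :
  (forall X : completeNormedModType R,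
     dual_isometric_ell1 X -> BPBp_nu_compact X) /\
  (forall X : completeNormedModType R[i],
     dual_isometric_ell1 X -> BPBp_nu_compact X).
Proof.
split=> X.
  by move=> /(dual_isometric_ell1_basis (real_scalars R))[e [coef eB]];
    exact: ell1_basis_BPBp_nu_compact eB.
by move=> /(dual_isometric_ell1_basis (complex_scalars R))[e [coef eB]];
  exact: ell1_basis_BPBp_nu_compact eB.
Qed.
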